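(* The Identification problem is NP-complete on instances $(G,H)$ where $H$ is both a split graph and an interval graph and has exactly two simplicial vertices.
   Context: All graphs are finite, simple and undirected. An identification of two distinct vertices $u,v$ replaces them with a new vertex adjacent to every vertex of $(N(u)\cup N(v))\setminus\{u,v\}$. The Identification problem takes as input two graphs $G$ and $H$ and asks whether $G$ can be transformed into a graph isomorphic to $H$ by a (possibly empty) sequence of identifications. A split graph is a graph whose vertex set can be partitioned into a clique and an independent set; an interval graph is the intersection graph of a family of intervals of the real line. A vertex is simplicial if its neighborhood is a clique. *)

(* Defs.v *)
From Stdlib Require Import Rdefinitions.
From mathcomp Require Import all_boot all_order ssralg poly interval.
From mathcomp Require Import Rstruct.

Set Implicit Arguments.
Unset Strict Implicit.
Unset Printing Implicit Defensive.

Record sgraph := SGraph {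
  vertex :> finType;
  adj : rel vertex;
  adj_sym : symmetric adj;
  adj_irr : irreflexive adj }.

Arguments adj {s} : rename.

Definition graph_iso (G H : sgraph) : Prop :=
  exists2 f : G -> H, bijective f & forall x y, adj (f x) (f y) = adj x y.

(* [None] is the vertex that replaces [u] and [v]. *)
Definition identify_adj (G : sgraph) (u v : G) :
    rel (option {x : G | (x != u) && (x != v)}) :=
  fun a b =>
    match a, b with
    | Some x, Some y => adj (val x) (val y)
    | None, Some y => adj u (val y) || adj v (val y)
    | Some x, None => adj u (val x) || adj v (val x)
    | None, None => false
    end.

Arguments identify_adj {G} u v _ _.

Lemma identify_sym (G : sgraph) (u v : G) : symmetric (identify_adj u v).
Proof. by move=> [x|] [y|] //=; apply: adj_sym. Qed.

Lemma identify_irr (G : sgraph) (u v : G) : irreflexive (identify_adj u v).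
Proof. by move=> [x|] //=; apply: adj_irr. Qed.

Definition identify (G : sgraph) (u v : G) : sgraph :=
  SGraph (@identify_sym G u v) (@identify_irr G u v).

Inductive identifies_to : sgraph -> sgraph -> Prop :=
| Identify_done (G H : sgraph) : graph_iso G H -> identifies_to G H
| Identify_step (G H : sgraph) (u v : G) :
    u != v -> identifies_to (identify u v) H -> identifies_to G H.

Definition clique (G : sgraph) (K : {set G}) : bool :=
  [forall x in K, forall y in K, (x != y) ==> adj x y].

Definition independent (G : sgraph) (S : {set G}) : bool :=
  [forall x in S, forall y in S, ~~ adj x y].

Definition split_graph (G : sgraph) : Prop :=
  exists K : {set G}, clique K && independent (~: K).

Definition interval_graph (G : sgraph) : Prop :=
  exists J : G -> interval R,
    forall x y : G, x != y ->
      (adj x y <-> exists r : R, (r \in J x) && (r \in J y)).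

Definition simplicial (G : sgraph) (v : G) : bool :=
  clique [set x | adj v x].

(* Deterministic multi-tape Turing machines.  Tapes are infinite in both
   directions; the symbol [None] is the blank, [Some (inl b)] an input/output
   bit and [Some (inr g)] an auxiliary symbol.  Tape [ord0] holds the input
   at the start and the output at the end. *)

Definition word := seq bool.

Inductive direction := MoveL | MoveR | Stay.

Definition cell (Gamma : finType) := option (bool + Gamma).

Record TM := MkTM {
  tm_aux : finType;
  tm_ntapes_pred : nat;
  tm_state : finType;
  tm_start : tm_state;
  tm_halt : pred tm_state;
  tm_trans : tm_state -> tm_ntapes_pred.+1.-tuple (cell tm_aux) ->
             tm_state * tm_ntapes_pred.+1.-tuple (cell tm_aux * direction) }.

(* [tleft] lists the cells to the left of the head, nearest first, and
   [tright] those to the right; all cells not listed are blank. *)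
Record tape (Gamma : finType) := Tape {
  tleft : seq (cell Gamma);
  tcur : cell Gamma;
  tright : seq (cell Gamma) }.

Definition blank_tape (Gamma : finType) : tape Gamma := Tape [::] None [::].

Definition input_tape (Gamma : finType) (x : word) : tape Gamma :=
  let s := [seq Some (inl b) | b <- x] in
  Tape [::] (head None s) (behead s).

Definition tape_act (Gamma : finType) (t : tape Gamma)
    (a : cell Gamma * direction) : tape Gamma :=
  let: (c, m) := a in
  match m with
  | MoveL => Tape (behead (tleft t)) (head None (tleft t)) (c :: tright t)
  | MoveR => Tape (c :: tleft t) (head None (tright t)) (behead (tright t))
  | Stay => Tape (tleft t) c (tright t)
  end.

Fixpoint leading_bits (Gamma : finType) (s : seq (cell Gamma)) : word :=
  if s is Some (inl b) :: s' then b :: leading_bits s' else [::].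

Record config (M : TM) := Config {
  cstate : tm_state M;
  ctapes : (tm_ntapes_pred M).+1.-tuple (tape (tm_aux M)) }.

Definition tm_init (M : TM) (x : word) : config M :=
  Config (tm_start M)
    [tuple (if i == ord0 then input_tape (tm_aux M) x
            else blank_tape (tm_aux M)) | i < (tm_ntapes_pred M).+1].

Definition tm_step (M : TM) (c : config M) : config M :=
  if tm_halt (cstate c) then c else
  let: (q, acts) := tm_trans (cstate c) [tuple of map (@tcur _) (ctapes c)] in
  Config q
    [tuple tape_act (tnth (ctapes c) i) (tnth acts i)
       | i < (tm_ntapes_pred M).+1].

Definition tm_output (M : TM) (c : config M) : word :=
  let t := tnth (ctapes c) ord0 in leading_bits (tcur t :: tright t).

(* Halted configurations are fixed by [tm_step], so this says that [M] halts
   on [x] within [t] steps with output [y]. *)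
Definition tm_computes_within (M : TM) (x : word) (t : nat) (y : word) : Prop :=
  let c := iter t (@tm_step M) (tm_init M x) in
  tm_halt (cstate c) /\ tm_output c = y.

Definition polytime (f : word -> word) : Prop :=
  exists (M : TM) (p : {poly nat}),
    forall x : word, tm_computes_within M x p.[size x]%R (f x).

Definition pair_word (x y : word) : word :=
  flatten [seq [:: true; b] | b <- x] ++ false :: y.

Definition in_NP (L : word -> Prop) : Prop :=
  exists (V : word -> word) (p : {poly nat}), polytime V /\
    forall x : word, L x <->
      exists y : word, size y <= p.[size x]%R /\ V (pair_word x y) = [:: true].

Record problem := Problem {
  instance : Type;
  code : instance -> word;
  yes : instance -> Prop }.

Definition language (P : problem) : word -> Prop :=
  fun w => exists2 i : instance P, w = code i & yes i.

Definition restrict (P : problem) (D : instance P -> Prop) : problem :=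
  {| instance := {i : instance P | D i};
     code := fun i => code (proj1_sig i);
     yes := fun i => yes (proj1_sig i) |}.

(* A reduction must produce the code of a legal instance on every input; this
   matters for restricted problems. *)
Definition NP_hard (P : problem) : Prop :=
  forall L : word -> Prop, in_NP L ->
    exists f : word -> word, polytime f /\
      forall x : word,
        (exists i : instance P, f x = code i) /\ (L x <-> language P (f x)).

Definition NP_complete (P : problem) : Prop :=
  in_NP (language P) /\ NP_hard P.

(* The number of vertices in unary, then the adjacency matrix row by row. *)
Definition graph_code (G : sgraph) : word :=
  nseq #|G| true ++ false :: [seq adj x y | x <- enum G, y <- enum G].

Definition Identification : problem :=
  {| instance := sgraph * sgraph;
     code := fun GH => pair_word (graph_code GH.1) (graph_code GH.2);
     yes := fun GH => identifies_to GH.1 GH.2 |}.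

(* Main.v *)
Require Import Defs.
From Stdlib Require Import Rdefinitions FunctionalExtensionality.
From mathcomp Require Import all_boot all_order ssralg ssrnum poly interval.
From mathcomp Require Import Rstruct.
From mathcomp Require Import zify.

(** A graph [G] can be turned into [H] by identifications iff there is a
    surjection [f : G -> H] such that distinct vertices of [H] are adjacent iff
    some edge of [G] joins their fibres.  This map is the certificate for
    membership in NP.  A graph is in the class iff it has exactly two simplicial
    vertices and its other vertices form a clique: split graphs have simplicial
    vertices in their independent side, so that side has at most two elements,
    and then the graph is automatically an interval graph.

    Hardness goes through hypergraph 2-colouring.  Let [G] consist of a clique
    of [k] hyperedges and an independent set of points, joined by incidence, and
    let [H] be the complete graph on [k + 2] vertices minus one edge.  Fibres
    without hyperedges are pairwise non-adjacent, so there are at most two of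
    them; counting shows that there are exactly two and that every other fibre
    contains exactly one hyperedge.  The two exceptional fibres are then
    disjoint sets of points that both meet every hyperedge.  A CNF formula is a
    2-colouring instance whose points are the literals and a point "false" that
    is added to every clause.  The formula describes the computation of the
    verifier in coordinates relative to the tape heads, where each column of
    the next configuration depends only on three neighbouring columns and on
    column 0.

    Polynomial running times come from a language of bounded arithmetic
    expressions and word comprehensions: it is compiled to a while-language on
    bit stacks and then to multi-tape Turing machines, one tape per stack, so
    every function it defines is computable in polynomial time.  Both the
    verifier and the reduction are written in this language. *)

Set Implicit Arguments.
Unset Strict Implicit.
Unset Printing Implicit Defensive.

(** * Stack programs and their Turing machines *)

Inductive cmd :=
| Skip
| Push of nat & bool
| Pop of nat
| Seq of cmd & cmd
| If of nat & (option bool -> bool) & cmd & cmd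
| While of nat & cmd.

Definition store := nat -> seq bool.

Definition upd (s : store) (r : nat) (v : seq bool) : store :=
  fun q => if q == r then v else s q.

(** The counts are the exact numbers of machine steps: a push moves left and then writes, every test
    of [If] or [While] takes a step of its own, and sequencing is free. *)
Inductive exec : cmd -> store -> nat -> store -> Prop :=
| ESkip s : exec Skip s 1 s
| EPush r b s : exec (Push r b) s 2 (upd s r (b :: s r))
| EPop r s : exec (Pop r) s 1 (upd s r (behead (s r)))
| ESeq c1 c2 s n1 s1 n2 s2 :
    exec c1 s n1 s1 -> exec c2 s1 n2 s2 -> exec (Seq c1 c2) s (n1 + n2) s2
| EIf r p c1 c2 s n s1 :
    exec (if p (ohead (s r)) then c1 else c2) s n s1 ->
    exec (If r p c1 c2) s n.+1 s1
| EWhileNil r c s : s r = [::] -> exec (While r c) s 1 s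
| EWhileCons r c s n1 s1 n2 s2 :
    s r <> [::] -> exec c s n1 s1 -> exec (While r c) s1 n2 s2 ->
    exec (While r c) s (n1 + n2).+1 s2.

(** Control states are positions in the syntax tree; the extra [None] of [If] and [While] is the
    state in which the test is made. *)
Fixpoint pc (c : cmd) : finType :=
  match c with
  | Skip | Pop _ => unit
  | Push _ _ => bool
  | Seq a b => (pc a + pc b)%type
  | If _ _ a b => option (pc a + pc b)%type
  | While _ a => option (pc a)
  end.

Fixpoint pc_start (c : cmd) : pc c :=
  match c with
  | Skip | Pop _ => tt
  | Push _ _ => false
  | Seq a b => inl (pc_start a)
  | If _ _ a b => None
  | While _ a => None
  end.

Definition action := option (nat * (option bool * direction)).

(** A next state [None] means that the command is left. A step acts on at most one tape; the first
    step of a push writes back the scanned symbol while moving left. *)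
Fixpoint delta (c : cmd) : pc c -> (nat -> option bool) -> option (pc c) * action :=
  match c with
  | Skip => fun _ _ => (None, None)
  | Pop r => fun _ _ => (None, Some (r, (None, MoveR)))
  | Push r b => fun s rd =>
      if s then (None, Some (r, (Some b, Stay)))
      else (Some true, Some (r, (rd r, MoveL)))
  | Seq a b => fun s rd =>
      match s with
      | inl s => let: (o, x) := delta s rd in
          (Some (if o is Some s' then inl s' else inr (pc_start b)), x)
      | inr s => let: (o, x) := delta s rd in (omap inr o, x)
      end
  | If r p a b => fun s rd =>
      match s with
      | None => (Some (Some (if p (rd r) then inl (pc_start a)
                             else inr (pc_start b))), None)
      | Some (inl s) => let: (o, x) := delta s rd in (omap (Some \o inl) o, x)
      | Some (inr s) => let: (o, x) := delta s rd in (omap (Some \o inr) o, x)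
      end
  | While r a => fun s rd =>
      match s with
      | None => (if rd r is Some _ then Some (Some (pc_start a)) else None, None)
      | Some s => let: (o, x) := delta s rd in (Some o, x)
      end
  end.

Definition cell_of (o : option bool) : cell void := omap inl o.

Definition bit_of (c : cell void) : option bool :=
  if c is Some (inl b) then Some b else None.

Lemma bit_ofK : cancel bit_of cell_of.
Proof. by case=> [[b|[]]|]. Qed.

Definition tapes := nat -> tape void.

Definition reads (T : tapes) : nat -> option bool :=
  fun r => bit_of (tcur (T r)).

Definition act (a : action) (T : tapes) : tapes :=
  fun q => if a is Some (r, (o, d)) then
             if q == r then tape_act (T q) (cell_of o, d) else T q
           else T q.

Inductive run (c : cmd) : pc c -> tapes -> nat -> tapes -> Prop :=
| RunExit s T x : delta s (reads T) = (None, x) -> run s T 1 (act x T)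
| RunStep s s' T x n T' : delta s (reads T) = (Some s', x) ->
    run s' (act x T) n T' -> run s T n.+1 T'.

Lemma run_seql a b s T n1 T1 n2 T2 :
  run s T n1 T1 -> run (pc_start b) T1 n2 T2 ->
  @run (Seq a b) (inl s) T (n1 + n2) T2.
Proof.
elim=> [{}s {}T x e|{}s s' {}T x n T' e _ IH] r2.
  rewrite add1n; apply: (RunStep (c := Seq a b) (s' := inr (pc_start b)) (x := x)) => /=.
    by rewrite e.
  elim: r2 => [{e}s {}T1 {}x e|{e}s {}s' {}T1 {}x n T' e _ IH].
    by apply: RunExit => /=; rewrite e.
  by apply: RunStep IH => /=; rewrite e.
by rewrite addSn; apply: RunStep (IH r2) => /=; rewrite e.
Qed.

Lemma run_ifl r p a b s T n T1 :
  run s T n T1 -> @run (If r p a b) (Some (inl s)) T n T1.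
Proof.
elim=> [{}s {}T x e|{}s s' {}T x {}n T' e _ IH].
  by apply: RunExit => /=; rewrite e.
by apply: RunStep IH => /=; rewrite e.
Qed.

Lemma run_ifr r p a b s T n T1 :
  run s T n T1 -> @run (If r p a b) (Some (inr s)) T n T1.
Proof.
elim=> [{}s {}T x e|{}s s' {}T x {}n T' e _ IH].
  by apply: RunExit => /=; rewrite e.
by apply: RunStep IH => /=; rewrite e.
Qed.

Lemma run_body r a s T n1 T1 n2 T2 :
  run s T n1 T1 -> @run (While r a) None T1 n2 T2 ->
  @run (While r a) (Some s) T (n1 + n2) T2.
Proof.
elim=> [{}s {}T x e|{}s s' {}T x n T' e _ IH] r2.
  by rewrite add1n; apply: RunStep r2 => /=; rewrite e.
by rewrite addSn; apply: RunStep (IH r2) => /=; rewrite e.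
Qed.

(* Stack [r] is tape [r] read rightwards from its head; what lies to the left
   of the head is garbage. *)
Definition holds (T : tapes) (s : store) : Prop :=
  forall r, exists m, tcur (T r) :: tright (T r) =
    [seq Some (inl b) | b <- s r] ++ nseq m None.

Lemma reads_holds T s : holds T s -> forall r, reads T r = ohead (s r).
Proof.
move=> h r; case: (h r) => m; rewrite /reads.
by case: (s r) => [|b v] /=; [case: m => // m [->] | case=> ->].
Qed.

(** Induction on the execution: each rule of [exec] corresponds to a run of the same length, and
    [holds] is kept because pushing overwrites the garbage cell to the left of the head. *)
Lemma exec_run c s n s' : exec c s n s' ->
  forall T, holds T s -> exists2 T', run (pc_start c) T n T' & holds T' s'.
Proof.
elim=> {c s n s'}.
- move=> s T hT; exists T => //.
  by apply: (@RunExit Skip _ _ None).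
- move=> r b s T hT.
  exists (act (Some (r, (Some b, Stay))) (act (Some (r, (reads T r, MoveL))) T)).
    by apply: (RunStep (c := Push r b)); [reflexivity | apply: RunExit].
  move=> q; rewrite /act /upd; case: eqP => [->|_]; last exact: hT.
  case: (hT r) => m e; exists m => /=.
  by rewrite bit_ofK e.
- move=> r s T hT.
  exists (act (Some (r, (None, MoveR))) T); first exact: (@RunExit (Pop r)).
  move=> q; rewrite /act /upd; case: eqP => [->|_]; last exact: hT.
  (* If no cell is listed to the right of the head, the move lands on an unlisted blank, and the
     padding becomes 1. *)
  case: (hT r) => m /=; case: (s r) => [|b v] /=.
    case: m => // m [_ ->]; case: m => [|m]; first by exists 1.
    by exists m.+1.
  case=> _ ->; case: v => [|b' v] /=.
    by case: m => [|m]; [exists 1 | exists m.+1].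
  by exists m.
- move=> c1 c2 s n1 s1 n2 s2 _ IH1 _ IH2 T hT.
  have [T1 r1 h1] := IH1 T hT; have [T2 r2 h2] := IH2 T1 h1.
  by exists T2 => //; apply: run_seql r1 r2.
- move=> r p c1 c2 s n s1 _ IH T hT.
  have [T1 r1 h1] := IH T hT; exists T1 => //.
  apply: (RunStep (c := If r p c1 c2) (x := None)); first reflexivity.
  rewrite (reads_holds hT).
  by case: (p _) r1 => r1; [apply: run_ifl | apply: run_ifr].
- move=> r c s e T hT; exists T => //.
  apply: (@RunExit (While r c) None T None) => /=.
  by rewrite (reads_holds hT) e.
- move=> r c s n1 s1 n2 s2 ne _ IH1 _ IH2 T hT.
  have [T1 r1 h1] := IH1 T hT; have [T2 r2 h2] := IH2 T1 h1.
  exists T2 => //.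
  apply: (RunStep (c := While r c) (s' := Some (pc_start c)) (x := None)) => /=.
    by rewrite (reads_holds hT); case: (s r) ne.
  exact: run_body r1 r2.
Qed.

Fixpoint maxreg (c : cmd) : nat :=
  match c with
  | Skip => 0
  | Push r _ | Pop r => r
  | Seq a b => maxn (maxreg a) (maxreg b)
  | If r _ a b => maxn r (maxn (maxreg a) (maxreg b))
  | While r a => maxn r (maxreg a)
  end.

(** Transitions inspect only tapes up to [maxreg c], so finitely many tapes can stand for the
    infinite family of registers. *)
Lemma eq_delta c (s : pc c) rd rd' :
  (forall r, r <= maxreg c -> rd r = rd' r) -> delta s rd = delta s rd'.
Proof.
elim: c s => [|r b|r|a IHa b IHb|r p a IHa b IHb|r a IHa] //= s h.
- by rewrite h.
- by case: s => s; [rewrite IHa | rewrite IHb] => // r hr; apply: h; lia.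
- case: s => [[s|s]|]; last by rewrite h // leq_maxl.
    by rewrite IHa // => q hq; apply: h; lia.
  by rewrite IHb // => q hq; apply: h; lia.
- case: s => [s|]; last by rewrite h // leq_maxl.
  by rewrite IHa // => q hq; apply: h; lia.
Qed.

(** Tapes that the step does not touch get their scanned symbol written back, and leaving the whole
    program is the halting state. *)
Definition tm_of (c : cmd) : TM :=
  @MkTM void (maxreg c) (option (pc c)) (Some (pc_start c)) (fun o => o == None)
    (fun o rd =>
       if o is Some s then
         let: (o', x) := delta s (fun r => bit_of (nth None rd r)) in
         (o', [tuple (if x is Some (r, (v, d)) then
                        if val i == r then (cell_of v, d) else (tnth rd i, Stay)
                      else (tnth rd i, Stay)) | i < (maxreg c).+1])
       else (None, [tuple (None, Stay) | i < (maxreg c).+1])).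

Definition conf (c : cmd) (o : option (pc c)) (T : tapes) : config (tm_of c) :=
  @Config (tm_of c) o [tuple T (val i) | i < (maxreg c).+1].

Lemma tape_act_id (T : tape void) : tape_act T (tcur T, Stay) = T.
Proof. by case: T. Qed.

Lemma tm_step_conf c (s : pc c) T o x : delta s (reads T) = (o, x) ->
  tm_step (conf (Some s) T) = conf o (act x T).
Proof.
move=> e; rewrite /tm_step /=.
rewrite (@eq_delta c s _ (reads T)); last first.
  move=> r hr.
  rewrite (nth_map (T 0)) ?size_tuple ?card_ord ?ltnS // /reads.
  by have /= <- := tnth_nth (T 0) [tuple T (val i) | i < (maxreg c).+1]
       (Ordinal (hr : r < (maxreg c).+1)); rewrite tnth_mktuple.
rewrite e /conf; congr Config; apply: eq_from_tnth => i.
rewrite !tnth_mktuple /act.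
have hid : tape_act (T i) (tcur (T i), Stay) = T i by apply: tape_act_id.
case: x e => [[r [v d]]|] _; last by rewrite tnth_map tnth_mktuple hid.
by case: eqP => // _; rewrite tnth_map tnth_mktuple hid.
Qed.

Lemma run_iter c (s : pc c) T n T' : run s T n T' ->
  iter n (@tm_step (tm_of c)) (conf (Some s) T) = conf None T'.
Proof.
elim=> [{}s {}T x e|{}s s' {}T x {}n {}T' e _ IH].
  by rewrite /= (tm_step_conf e).
by rewrite iterSr (tm_step_conf e) IH.
Qed.

Definition init_store (w : word) : store := fun r => if r == 0 then w else [::].

Lemma leading_bits_map (G : finType) (v : seq bool) m :
  @leading_bits G ([seq Some (inl b) | b <- v] ++ nseq m None) = v.
Proof. by elim: v => [|b v IH] /=; [case: m | rewrite IH]. Qed.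

Lemma iter_halted M t (c : config M) :
  tm_halt (cstate c) -> iter t (@tm_step M) c = c.
Proof. by move=> h; elim: t => //= t ->; rewrite /tm_step h. Qed.

Lemma horner_X2_exp (m k : nat) : (('X + 2%:P) ^+ k).[m]%R = (m + 2) ^ k.
Proof.
rewrite horner_exp hornerD hornerX hornerC.
by elim: k => // k IH; rewrite GRing.exprS IH expnS.
Qed.

Lemma exec_polytime c (f : word -> word) k :
  (forall w, exists n s, [/\ exec c (init_store w) n s, s 0 = f w &
     n <= (size w + 2) ^ k]) -> polytime f.
Proof.
move=> h; exists (tm_of c), (('X + 2%:P) ^+ k)%R => w.
have [n [s [ex e le]]] := h w.
pose T : tapes := fun r => if r == 0 then input_tape void w else blank_tape void.
have hT : holds T (init_store w).
  move=> r; rewrite /T /init_store; case: eqP => _; last by exists 1.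
  by case: w {h ex e le T} => [|b w]; [exists 1 | exists 0; rewrite /= cats0].
have [T' rn h'] := exec_run ex hT.
have -> : (('X + 2%:P) ^+ k).[size w]%R = (size w + 2) ^ k.
  exact: horner_X2_exp.
rewrite /tm_computes_within.
have -> : tm_init (tm_of c) w = conf (Some (pc_start c)) T.
  by rewrite /tm_init /conf; congr Config; apply: eq_from_tnth => i;
     rewrite !tnth_mktuple.
rewrite -(subnK le) iterD (run_iter rn) iter_halted //; split=> //.
have [m hm] := h' 0.
by rewrite /tm_output tnth_mktuple hm leading_bits_map.
Qed.

(** * Running times of stack programs *)

(** The base is at least 2, so a larger exponent absorbs constants and one extra factor absorbs a
    sum. *)
Definition polyb (g : nat -> nat) : Prop :=
  exists k, forall B, g B <= (B + 2) ^ k.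

Lemma polyb_le g h : polyb h -> (forall B, g B <= h B) -> polyb g.
Proof. by move=> [k hk] le; exists k => B; apply: leq_trans (le B) (hk B). Qed.

Lemma polyb_cst n : polyb (fun=> n).
Proof.
exists n => B; apply: (@leq_trans (2 ^ n)); first exact: ltnW (ltn_expl _ _).
by case: n => // n; rewrite leq_exp2r // addn2.
Qed.

Lemma polyb_id : polyb id.
Proof. by exists 1 => B; rewrite expn1 leq_addr. Qed.

Lemma polybD g h : polyb g -> polyb h -> polyb (fun B => g B + h B).
Proof.
move=> [k hk] [l hl]; exists (maxn k l).+1 => B.
have X0 : 0 < B + 2 by lia.
have a1 : g B <= (B + 2) ^ maxn k l.
  by apply: leq_trans (hk B) _; rewrite leq_pexp2l // leq_maxl.
have a2 : h B <= (B + 2) ^ maxn k l.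
  by apply: leq_trans (hl B) _; rewrite leq_pexp2l // leq_maxr.
by rewrite expnS; nia.
Qed.

Lemma polybM g h : polyb g -> polyb h -> polyb (fun B => g B * h B).
Proof.
by move=> [k hk] [l hl]; exists (k + l) => B; rewrite expnD leq_mul.
Qed.

Lemma polyb_comp g h : polyb g -> polyb h -> polyb (fun B => g (h B)).
Proof.
move=> [k hk] hh.
have [l hl] : polyb (fun B => h B + 2) by apply: polybD hh (polyb_cst 2).
exists (l * k) => B; apply: leq_trans (hk _) _.
by rewrite expnM; case: k {hk} => // k; rewrite leq_exp2r.
Qed.

Definition runs (c : cmd) (s s' : store) (b : nat) : Prop :=
  exists2 n, n <= b & exec c s n s'.

Lemma runsW c s s' b b' : runs c s s' b -> b <= b' -> runs c s s' b'.
Proof. by move=> [n le ex] h; exists n => //; apply: leq_trans h. Qed.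

Lemma runs_eq c s s' s'' b : runs c s s' b -> s' = s'' -> runs c s s'' b.
Proof. by move=> h <-. Qed.

Lemma runs_skip s : runs Skip s s 1.
Proof. by exists 1 => //; constructor. Qed.

Lemma runs_push r v s : runs (Push r v) s (upd s r (v :: s r)) 2.
Proof. by exists 2 => //; constructor. Qed.

Lemma runs_pop r s : runs (Pop r) s (upd s r (behead (s r))) 1.
Proof. by exists 1 => //; constructor. Qed.

Lemma runs_seq c1 c2 s s1 s2 b1 b2 :
  runs c1 s s1 b1 -> runs c2 s1 s2 b2 -> runs (Seq c1 c2) s s2 (b1 + b2).
Proof.
move=> [n1 l1 e1] [n2 l2 e2]; exists (n1 + n2); first exact: leq_add.
exact: ESeq e1 e2.
Qed.

Lemma runs_if r p c1 c2 s s' b :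
  runs (if p (ohead (s r)) then c1 else c2) s s' b -> runs (If r p c1 c2) s s' b.+1.
Proof. by move=> [n le e]; exists n.+1 => //; constructor. Qed.

Lemma runs_while r c (S : nat -> store) m b :
  (forall i, i < m -> S i r <> [::]) -> S m r = [::] ->
  (forall i, i < m -> runs c (S i) (S i.+1) b) ->
  runs (While r c) (S 0) (S m) (m * b.+1 + 1).
Proof.
elim: m S => [|m IH] S ne e h; first by exists 1 => //; constructor.
have [n1 l1 e1] := h 0 isT.
have [||n2 l2 e2] := IH (S \o succn) _ e.
- by move=> i; apply: (ne i.+1).
- by move=> i; apply: (h i.+1).
exists (n1 + n2).+1; last by apply: EWhileCons e1 e2; apply: ne.
by rewrite mulSn; lia.
Qed.

Ltac store_eq :=
  apply: functional_extensionality; let q := fresh "q" in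
  move=> q; rewrite /upd ?eqxx;
  repeat match goal with
  | |- context [?x == ?y :> nat] =>
      let h := fresh in have [h|h] := eqVneq x y;
      try (exfalso; lia)
  end; try (by []); try congruence.

Ltac at_reg :=
  rewrite /upd;
  repeat match goal with
  | |- context [?x == ?y :> nat] =>
      first [ have -> : (x == y) = true by lia
            | have -> : (x == y) = false by lia ]
  end; rewrite /=.

Lemma upd_same s r v : upd s r v r = v.
Proof. by rewrite /upd eqxx. Qed.

Lemma upd_neq s r v q : q != r -> upd s r v q = s q.
Proof. by rewrite /upd => /negbTE ->. Qed.

Lemma upd_id s r v : s r = v -> upd s r v = s.
Proof. by move=> e; store_eq; subst. Qed.

Definition is_true_bit : option bool -> bool := pred1 (Some true).

Definition mv (r d : nat) : cmd :=
  While r (Seq (If r is_true_bit (Push d true) (Push d false)) (Pop r)).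

Lemma runs_mv r d s : r != d ->
  runs (mv r d) s (upd (upd s r [::]) d (rev (s r) ++ s d)) (size (s r) * 5 + 1).
Proof.
move=> rd.
pose S i := upd (upd s r (drop i (s r))) d (rev (take i (s r)) ++ s d).
apply: (@runs_eq _ _ (S (size (s r)))); last by rewrite /S drop_size take_size.
have {1}-> : s = S 0 by rewrite /S drop0 take0 /=; store_eq; subst.
apply: runs_while => [i hi||i hi].
- rewrite /S upd_neq // upd_same => /(congr1 size); rewrite size_drop /=; lia.
- by rewrite /S upd_neq // upd_same drop_size.
have e : S i r = nth false (s r) i :: drop i.+1 (s r).
  by rewrite /S upd_neq // upd_same (drop_nth false).
have h1 : runs (If r is_true_bit (Push d true) (Push d false)) (S i)
    (upd (S i) d (nth false (s r) i :: S i d)) 3.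
  by apply: runs_if; rewrite e /=; case: (nth _ _ _); apply: runs_push.
apply: (runs_eq (runs_seq h1 (runs_pop _ _))).
rewrite upd_neq // e /= {h1 e} /S (take_nth false hi) rev_rcons /= upd_same.
by store_eq.
Qed.

Definition clear (r : nat) : cmd := While r (Pop r).

Lemma runs_clear r s : runs (clear r) s (upd s r [::]) (size (s r) * 2 + 1).
Proof.
pose S i := upd s r (drop i (s r)).
apply: (@runs_eq _ _ (S (size (s r)))); last by rewrite /S drop_size.
have {1}-> : s = S 0 by rewrite /S drop0; store_eq; subst.
apply: runs_while => [i hi||i hi].
- rewrite /S upd_same => /(congr1 size); rewrite size_drop /=; lia.
- by rewrite /S upd_same drop_size.
apply: (runs_eq (runs_pop _ _)).
by rewrite /S upd_same -drop1 drop_drop add1n; store_eq.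
Qed.

(* With [raw] the bits are copied; without it, only their number. *)
Definition copy (raw : bool) (r d : nat) : cmd :=
  Seq (mv r d.+1)
    (While d.+1
      (Seq (If d.+1 is_true_bit (Seq (Push r true) (Push d true))
              (Seq (Push r false) (Push d (~~ raw)))) (Pop d.+1))).

Lemma runs_copy raw r d s : r < d -> s d = [::] -> s d.+1 = [::] ->
  runs (copy raw r d) s
    (upd s d (if raw then s r else nseq (size (s r)) true)) (size (s r) * 12 + 2).
Proof.
move=> rd e1 e2.
have nd : r != d.+1 by lia.
have nd' : r != d by lia.
pose f b := b || ~~ raw.
set u := s r; set m := size u.
(* The first loop has put the stack in reverse on [d.+1]. After [i] rounds of the second loop the
   last [i] bits are back on [r] and their images under [f] are on [d]. *)
pose S i := upd (upd (upd s d.+1 (rev (take (m - i) u))) r (drop (m - i) u))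
  d (map f (drop (m - i) u)).
have -> : (if raw then u else nseq m true) = map f u.
  rewrite /f /m; case: (raw); first by elim: (u) => //= b v <-; case: b.
  by elim: (u) => //= b v ->; rewrite orbT.
apply: (@runs_eq _ _ (S m)); last first.
  by rewrite /S subnn take0 drop0; store_eq; subst; rewrite ?e2 //; congruence.
apply: (@runsW _ _ _ ((m * 5 + 1) + (m * 7.+1 - m + 1))); last by lia.
apply: (runs_seq (runs_mv _ nd)).
have -> : upd (upd s r [::]) d.+1 (rev (s r) ++ s d.+1) = S 0.
  rewrite /S subn0 take_size drop_size e2 cats0 -/u.
  by store_eq; subst; rewrite /= ?e1.
apply: (@runsW _ _ _ (m * 6.+1 + 1)); last by lia.
apply: runs_while => [i hi||i hi].
- rewrite /S; at_reg => /(congr1 size); rewrite size_rev size_take -/m /=.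
  by case: ifP; lia.
- by rewrite /S; at_reg; rewrite subnn take0.
have hmi : m - i = (m - i.+1).+1 by lia.
have hlt : m - i.+1 < size u by rewrite -/m; lia.
set b := nth false u (m - i.+1).
have e : S i d.+1 = b :: rev (take (m - i.+1) u).
  by rewrite /S; at_reg; rewrite hmi (take_nth false) // rev_rcons.
have h1 : runs (If d.+1 is_true_bit (Seq (Push r true) (Push d true))
      (Seq (Push r false) (Push d (~~ raw)))) (S i)
    (upd (upd (S i) r (b :: S i r)) d (f b :: S i d)) 5.
  apply: runs_if; rewrite e /= -[4]/(2 + 2) /f.
  by case: {e} b; apply: (runs_eq (runs_seq (runs_push _ _ _) (runs_push _ _ _)));
     rewrite /= upd_neq //; lia.
apply: (runs_eq (runs_seq h1 (runs_pop _ _))).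
have -> : upd (upd (S i) r (b :: S i r)) d (f b :: S i d) d.+1 = S i d.+1.
  by at_reg.
rewrite e /= {h1}.
have -> : S i r = drop (m - i) u by rewrite /S upd_neq ?upd_same.
have -> : S i d = map f (drop (m - i) u) by rewrite /S upd_same.
have hd : drop (m - i.+1) u = b :: drop (m - i) u by rewrite (drop_nth false) // hmi.
rewrite {e} /S hd /=.
by store_eq.
Qed.

(** * Bounded arithmetic and word comprehensions *)

(* [Var i] refers to the [i]-th bound variable counted from the outermost
   binder (de Bruijn levels), so binders extend the environment on the right. *)
Inductive expr :=
| Var of nat
| Cst of nat
| Size
| Bit of expr
| Add of expr & expr
| Mul of expr & expr
| Leq of expr & expr
| Sum of expr & expr.

Fixpoint eval (w : word) (env : seq nat) (e : expr) : nat :=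
  match e with
  | Var i => nth 0 env i
  | Cst n => n
  | Size => size w
  | Bit e => nth false w (eval w env e)
  | Add a b => eval w env a + eval w env b
  | Mul a b => eval w env a * eval w env b
  | Leq a b => eval w env a <= eval w env b
  | Sum a b => \sum_(i < eval w env a) eval w (rcons env i) b
  end.

Fixpoint pushes (d n : nat) : cmd :=
  if n is n'.+1 then Seq (pushes d n') (Push d true) else Skip.

(** Register [d] receives the value in unary and the registers above it are scratch. [Bit] pops a
    copy of the input along with the index until the wanted bit is on top, an empty stack counting
    as false. [Leq] computes the truncated difference and tests whether it is empty. In [Sum],
    [d.+1] counts down while [d.+2] holds the bound variable. *)
Fixpoint comp (d : nat) (rho : seq nat) (e : expr) : cmd :=
  match e with
  | Var i => if i < size rho then copy true (nth 0 rho i) d else Skip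
  | Cst n => pushes d n
  | Size => copy false 0 d
  | Bit e =>
      Seq (comp d rho e) (Seq (copy true 0 d.+1)
        (Seq (While d (Seq (Pop d) (Pop d.+1)))
          (Seq (If d.+1 is_true_bit (Push d true) Skip) (clear d.+1))))
  | Add a b => Seq (comp d rho a) (Seq (comp d.+1 rho b) (mv d.+1 d))
  | Mul a b =>
      Seq (comp d.+1 rho a) (Seq (comp d.+2 rho b)
        (Seq (While d.+1 (Seq (copy true d.+2 d.+3) (Seq (mv d.+3 d) (Pop d.+1))))
          (clear d.+2)))
  | Leq a b =>
      Seq (comp d rho a) (Seq (comp d.+1 rho b)
        (Seq (While d.+1 (Seq (Pop d.+1) (Pop d)))
          (If d isSome (clear d) (Push d true))))
  | Sum a b =>
      Seq (comp d.+1 rho a)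
        (Seq (While d.+1 (Seq (Pop d.+1)
          (Seq (comp d.+3 (rcons rho d.+2) b) (Seq (mv d.+3 d) (Push d.+2 true)))))
          (clear d.+2))
  end.

Definition unary (n : nat) : seq bool := nseq n true.

Lemma unaryS n : true :: unary n = unary n.+1. Proof. by []. Qed.

Lemma size_unary n : size (unary n) = n. Proof. exact: size_nseq. Qed.

Lemma rev_unary_cat m n : rev (unary m) ++ unary n = unary (n + m).
Proof. by rewrite /unary rev_nseq -nseqD addnC. Qed.

Lemma behead_unary n : behead (unary n) = unary n.-1.
Proof. by case: n. Qed.

(* Registers 0 and 1 hold the input and the output, [rho] lists the registers
   of the bound variables, and the registers from [d] on are free. *)
Definition frame (rho env : seq nat) (d : nat) (s : store) (B : nat) : Prop :=
  [/\ 1 < d, forall r, d <= r -> s r = [::], size rho = size env,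
      forall i, i < size rho -> 1 < nth 0 rho i < d /\
        s (nth 0 rho i) = unary (nth 0 env i) &
      size (s 0) <= B /\ forall i, nth 0 env i <= B].

Lemma frame_upd rho env d s B r v : d <= r \/ r = 1 ->
  frame rho env d s B -> (forall q, d < q -> upd s r v q = [::]) ->
  frame rho env d.+1 (upd s r v) B.
Proof.
move=> hr [d1 cl sz hv [b1 b2]] h; split=> //; try lia.
- move=> i /hv [h1 h2]; split; first lia.
  by rewrite upd_neq ?h2 //; lia.
- by split=> //; rewrite upd_neq //; lia.
Qed.

Lemma frameS rho env d s B v : frame rho env d s B -> frame rho env d.+1 (upd s d v) B.
Proof.
move=> f; apply: frame_upd (f) _; first by left.
by move=> q hq; case: f => _ cl _ _ _; rewrite upd_neq ?cl //; lia.
Qed.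

Lemma frameS0 rho env d s B : frame rho env d s B -> frame rho env d.+1 s B.
Proof.
move=> f; rewrite -(@upd_id s d [::]); first exact: frameS.
by case: f => _ cl _ _ _; apply: cl.
Qed.

Lemma frame_out rho env d s B v : frame rho env d s B -> frame rho env d (upd s 1 v) B.
Proof.
move=> [d1 cl sz hv [b1 b2]]; split=> //.
- by move=> r hr; rewrite upd_neq ?cl //; lia.
- by move=> i /hv [h1 h2]; split=> //; rewrite upd_neq ?h2 //; lia.
Qed.

Lemma frameW rho env d s B B' : B <= B' -> frame rho env d s B -> frame rho env d s B'.
Proof.
move=> le [d1 cl sz hv [b1 b2]]; split=> //; split; first exact: leq_trans le.
by move=> i; apply: leq_trans le.
Qed.

Lemma frame_bind rho env d s B v : v <= B -> frame rho env d s B ->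
  frame (rcons rho d) (rcons env v) d.+1 (upd s d (unary v)) B.
Proof.
move=> hv /[dup] f [d1 cl sz hr [b1 b2]].
have [_ cl' _ _ [b1' _]] := frameS (unary v) f.
split=> //; rewrite ?size_rcons ?sz //; first lia.
- move=> i; rewrite ltnS leq_eqVlt !nth_rcons sz => /orP[/eqP ->|h].
    by rewrite ltnn eqxx upd_same; split=> //; lia.
  rewrite h; have [h1 h2] := hr i ltac:(by rewrite sz); split; first lia.
  by rewrite upd_neq //; lia.
- split=> // i; rewrite nth_rcons; case: ifP => _; first exact: b2.
  by case: ifP.
Qed.

Lemma runs_pushes d n s : s d = [::] -> runs (pushes d n) s (upd s d (unary n)) (2 * n + 1).
Proof.
move=> e; elim: n => [|n IH] /=; first by rewrite upd_id //; apply: runs_skip.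
apply: (@runsW _ _ _ ((2 * n + 1) + 2)); last lia.
apply: (runs_eq (runs_seq IH (runs_push _ _ _))).
by rewrite upd_same; store_eq.
Qed.

(** One function bounds both the time and the value, because values of subexpressions become loop
    counts of the expressions around them. *)
Definition comp_spec (e : expr) (g : nat -> nat) : Prop :=
  forall d rho env s B, frame rho env d s B ->
    runs (comp d rho e) s (upd s d (unary (eval (s 0) env e))) (g B) /\
    eval (s 0) env e <= g B.

Ltac pb := by repeat first [exact: polyb_cst | exact: polyb_id | assumption
  | apply: polybD | apply: polybM | apply: polyb_comp].

Lemma comp_var i : comp_spec (Var i) (fun B => B * 12 + 2).
Proof.
move=> d rho env s B [d1 cl sz hv [b1 b2]] /=.
split; last by have := b2 i; lia.
case: ifP => hi; last first.
  have -> : nth 0 env i = 0 by rewrite nth_default // -sz leqNgt hi.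
  rewrite upd_id; last exact: cl.
  by apply: runsW (runs_skip _) _; lia.
have [h1 h2] := hv i hi.
rewrite -h2; apply: runsW (runs_copy _ _ _ _) _; try (exact: cl); try lia.
by rewrite h2 size_unary; have := b2 i; lia.
Qed.

Lemma comp_cst n : comp_spec (Cst n) (fun=> 2 * n + 1).
Proof.
move=> d rho env s B [d1 cl sz hv [b1 b2]] /=; split; last lia.
by apply: runs_pushes; apply: cl.
Qed.

Lemma comp_size : comp_spec Size (fun B => B * 12 + 2).
Proof.
move=> d rho env s B [d1 cl sz hv [b1 b2]] /=; split; last lia.
by apply: runsW (runs_copy false _ _ _) _; try (exact: cl); lia.
Qed.

Lemma comp_bit e g : comp_spec e g ->
  comp_spec (Bit e) (fun B => g B + ((B * 12 + 2) + ((g B * 3 + 1) + (3 + (B * 2 + 1))))).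
Proof.
move=> h d rho env s B /[dup] f [d1 cl sz hv [b1 b2]] /=.
have [r1 l1] := h d rho env s B f.
set v := eval _ _ _ in r1 l1 *; split; last by case: nth; lia.
apply: (runs_seq r1).
set s1 := upd s d _.
have c1 : runs (copy true 0 d.+1) s1 (upd s1 d.+1 (s 0)) (B * 12 + 2).
  apply: runsW (runs_eq (runs_copy true _ _ _) _) _; try lia.
  - by rewrite /s1; at_reg; rewrite cl //; lia.
  - by rewrite /s1; at_reg; rewrite cl //; lia.
  - by rewrite /s1; congr upd; at_reg.
  by rewrite /s1; at_reg; lia.
apply: (runs_seq c1).
pose S i := upd (upd s d (unary (v - i))) d.+1 (drop i (s 0)).
have c2 : runs (While d (Seq (Pop d) (Pop d.+1))) (upd s1 d.+1 (s 0)) (S v) (g B * 3 + 1).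
  have -> : upd s1 d.+1 (s 0) = S 0 by rewrite /S /s1 subn0 drop0.
  apply: (@runsW _ _ _ (v * 3 + 1)); last by lia.
  apply: runs_while => [i hi||i hi].
  - by rewrite /S; at_reg => /(congr1 size); rewrite size_unary /=; lia.
  - by rewrite /S; at_reg; rewrite subnn.
  apply: (runs_eq (runs_seq (runs_pop _ _) (runs_pop _ _))).
  have -> : S i d = unary (v - i) by rewrite /S; at_reg.
  rewrite behead_unary [upd (S i) _ _ _]upd_neq; last lia.
  have -> : S i d.+1 = drop i (s 0) by rewrite /S; at_reg.
  by rewrite -drop1 drop_drop add1n /S subnS; store_eq.
apply: (runs_seq c2).
have e1 : S v d.+1 = drop v (s 0) by rewrite /S; at_reg.
set b := nth false (s 0) v.
have c3 : runs (If d.+1 is_true_bit (Push d true) Skip) (S v)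
    (upd (S v) d (unary b)) 3.
  have e2 : S v d = [::] by rewrite /S; at_reg; rewrite subnn.
  apply: runs_if; rewrite e1.
  have -> : is_true_bit (ohead (drop v (s 0))) = b.
    rewrite /b -[v in RHS]addn0 -nth_drop; case: (drop v _) => //= x l.
    by rewrite /is_true_bit /=; case: x.
  case: b; first by apply: (runs_eq (runs_push _ _ _)); rewrite e2.
  by rewrite upd_id //; apply: runsW (runs_skip _) _.
apply: (runs_seq c3).
apply: runsW (runs_eq (runs_clear _ _) _) _.
  by rewrite /S; store_eq; rewrite cl //; lia.
by rewrite upd_neq ?e1 ?size_drop; lia.
Qed.

Lemma comp_add a b ga gb : comp_spec a ga -> comp_spec b gb ->
  comp_spec (Add a b) (fun B => ga B + (gb B + (gb B * 5 + 1))).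
Proof.
move=> ha hb d rho env s B /[dup] f [d1 cl sz hv [b1 b2]] /=.
have [ra la] := ha _ _ _ _ _ f.
set v := eval _ _ a in ra la *.
have [rb lb] := hb _ _ _ _ _ (frameS (unary v) f).
have e0 : upd s d (unary v) 0 = s 0 by rewrite upd_neq //; lia.
rewrite e0 in rb lb; set u := eval _ _ b in rb lb *.
split; last lia.
apply: (runs_seq ra); apply: (runs_seq rb).
apply: runsW (runs_eq (runs_mv _ _) _) _; first lia.
  rewrite upd_same [upd (upd _ _ _) _ _ _]upd_neq; last lia.
  by rewrite upd_same rev_unary_cat; store_eq; rewrite cl //; lia.
by rewrite upd_same size_unary; lia.
Qed.

Lemma comp_leq a b ga gb : comp_spec a ga -> comp_spec b gb ->
  comp_spec (Leq a b) (fun B => ga B + (gb B + ((gb B * 3 + 1) + (ga B * 2 + 2).+1))).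
Proof.
move=> ha hb d rho env s B /[dup] f [d1 cl sz hv [b1 b2]] /=.
have [ra la] := ha _ _ _ _ _ f.
set v := eval _ _ a in ra la *.
have [rb lb] := hb _ _ _ _ _ (frameS (unary v) f).
have e0 : upd s d (unary v) 0 = s 0 by rewrite upd_neq //; lia.
rewrite e0 in rb lb; set u := eval _ _ b in rb lb *.
split; last by case: (v <= u); lia.
apply: (runs_seq ra); apply: (runs_seq rb).
pose S i := upd (upd s d (unary (v - i))) d.+1 (unary (u - i)).
have -> : upd (upd s d (unary v)) d.+1 (unary u) = S 0 by rewrite /S !subn0.
have c2 : runs (While d.+1 (Seq (Pop d.+1) (Pop d))) (S 0) (S u) (gb B * 3 + 1).
  apply: (@runsW _ _ _ (u * 3 + 1)); last by lia.
  apply: runs_while => [i hi||i hi].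
  - by rewrite /S; at_reg => /(congr1 size); rewrite size_unary /=; lia.
  - by rewrite /S; at_reg; rewrite subnn.
  apply: (runs_eq (runs_seq (runs_pop _ _) (runs_pop _ _))).
  have -> : S i d.+1 = unary (u - i) by rewrite /S; at_reg.
  rewrite behead_unary [upd (S i) _ _ _]upd_neq; last lia.
  have -> : S i d = unary (v - i) by rewrite /S; at_reg.
  by rewrite behead_unary /S !subnS; store_eq.
apply: (runs_seq c2).
have e1 : S u d = unary (v - u) by rewrite /S; at_reg.
have e2 : S u = upd s d (unary (v - u)).
  by rewrite /S subnn; store_eq; rewrite cl //; lia.
apply: runs_if; rewrite e1.
case: (posnP (v - u)) => h.
  rewrite h /= (_ : v <= u) ?e2; last lia.
  apply: runsW (runs_eq (runs_push _ _ _) _) _; last lia.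
  by rewrite upd_same h; store_eq.
rewrite (_ : (v <= u) = false); last lia.
rewrite -(prednK h) /=; apply: runsW (runs_eq (runs_clear _ _) _) _.
  by rewrite e2; store_eq.
by rewrite e1 size_unary; lia.
Qed.

Lemma comp_mul a b ga gb : comp_spec a ga -> comp_spec b gb ->
  comp_spec (Mul a b) (fun B => ga B + (gb B +
    ((ga B * ((gb B * 12 + 2) + ((gb B * 5 + 1) + 1)).+1 + 1) + (gb B * 2 + 1)))).
Proof.
move=> ha hb d rho env s B /[dup] f [d1 cl sz hv [b1 b2]] /=.
have [ra la] := ha _ _ _ _ _ (frameS0 f).
set v := eval _ _ a in ra la *.
have [rb lb] := hb _ _ _ _ _ (frameS (unary v) (frameS0 f)).
have e0 : upd s d.+1 (unary v) 0 = s 0 by rewrite upd_neq //; lia.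
rewrite e0 in rb lb; set u := eval _ _ b in rb lb *.
split; last by nia.
apply: (runs_seq ra); apply: (runs_seq rb).
pose S i := upd (upd (upd s d (unary (i * u))) d.+1 (unary (v - i))) d.+2 (unary u).
have -> : upd (upd s d.+1 (unary v)) d.+2 (unary u) = S 0.
  by rewrite /S !subn0 mul0n; store_eq; subst; apply: cl.
have c2 : runs (While d.+1 (Seq (copy true d.+2 d.+3) (Seq (mv d.+3 d) (Pop d.+1))))
    (S 0) (S v) (ga B * ((gb B * 12 + 2) + ((gb B * 5 + 1) + 1)).+1 + 1).
  apply: (@runsW _ _ _ (v * ((gb B * 12 + 2) + ((gb B * 5 + 1) + 1)).+1 + 1));
    last by rewrite leq_add2r leq_mul.
  apply: runs_while => [i hi||i hi].
  - by rewrite /S; at_reg => /(congr1 size); rewrite size_unary /=; lia.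
  - by rewrite /S; at_reg; rewrite subnn.
  have e2 : S i d.+2 = unary u by rewrite /S; at_reg.
  have e3 : S i d.+3 = [::] by rewrite /S; at_reg; rewrite cl //; lia.
  have e4 : S i d.+4 = [::] by rewrite /S; at_reg; rewrite cl //; lia.
  have c1 := @runs_copy true d.+2 d.+3 (S i) (ltnSn _) e3 e4.
  rewrite e2 size_unary /= in c1.
  apply: (@runs_seq _ _ _ _ _ (gb B * 12 + 2) _ (runsW c1 _)); first lia.
  apply: (@runs_seq _ _ _ _ _ (gb B * 5 + 1)).
    apply: runsW (runs_mv _ _) _; first lia.
    by rewrite upd_same size_unary; lia.
  apply: (runs_eq (runs_pop _ _)).
  rewrite upd_same [upd (S i) d.+3 _ d]upd_neq; last lia.
  have -> : S i d = unary (i * u) by rewrite /S; at_reg.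
  set X := (X in behead X).
  have -> : X = unary (v - i) by rewrite /X; at_reg; rewrite /S; at_reg.
  rewrite behead_unary rev_unary_cat; clear X; rewrite /S mulSn addnC subnS.
  by store_eq; rewrite cl //; lia.
apply: (runs_seq c2).
apply: runsW (runs_eq (runs_clear _ _) _) _.
  by rewrite /S subnn; store_eq; rewrite cl //; lia.
by rewrite /S upd_same size_unary; lia.
Qed.

Lemma comp_sum a b ga gb : comp_spec a ga -> comp_spec b gb ->
  comp_spec (Sum a b) (fun B => ga B +
    ((ga B * (1 + (gb (B + ga B) + ((gb (B + ga B) * 5 + 1) + 2))).+1 + 1)
     + (ga B * 2 + 1))).
Proof.
move=> ha hb d rho env s B /[dup] f [d1 cl sz hv [b1 b2]] /=.
have [ra la] := ha _ _ _ _ _ (frameS0 f).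
(* The body is evaluated with a bound variable below [v], which may exceed [B] but not [ga B]; hence
   the enlarged bound. *)
set v := eval _ _ a in ra la *; set B' := B + ga B.
pose F i := eval (s 0) (rcons env i) b.
pose P i := \sum_(j < i) F j.
pose S i := upd (upd (upd s d (unary (P i))) d.+1 (unary (v - i))) d.+2 (unary i).
pose S' i := upd (upd s d (unary (P i))) d.+1 (unary (v - i.+1)).
have hS' i : i < v ->
  runs (comp d.+3 (rcons rho d.+2) b) (upd (S' i) d.+2 (unary i))
    (upd (upd (S' i) d.+2 (unary i)) d.+3 (unary (F i))) (gb B') /\ F i <= gb B'.
  move=> hi.
  have fr : frame (rcons rho d.+2) (rcons env i) d.+3 (upd (S' i) d.+2 (unary i)) B'.
    apply: frame_bind; first by rewrite /B'; lia.
    by apply: frameS; apply: frameS; apply: frameW f; rewrite /B' leq_addr.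
  have := hb _ _ _ _ _ fr.
  by have -> : upd (S' i) d.+2 (unary i) 0 = s 0 by rewrite /S'; at_reg.
split; last first.
  have : P v <= v * gb B'.
    rewrite /P -[v in v * _]card_ord -sum_nat_const; apply: leq_sum => i _.
    by have [] := hS' i (ltn_ord i).
  have h2 : v * gb B' <= ga B * gb B' by rewrite leq_mul.
  by rewrite -/(P v) => h1; rewrite -/B' mulnS !mulnDr; lia.
apply: (runs_seq ra).
have -> : upd s d.+1 (unary v) = S 0.
  by rewrite /S !subn0 /P big_ord0; store_eq; subst; apply: cl; lia.
have c2 : runs (While d.+1 (Seq (Pop d.+1)
      (Seq (comp d.+3 (rcons rho d.+2) b) (Seq (mv d.+3 d) (Push d.+2 true)))))
    (S 0) (S v) (ga B * (1 + (gb B' + ((gb B' * 5 + 1) + 2))).+1 + 1).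
  apply: (@runsW _ _ _ (v * (1 + (gb B' + ((gb B' * 5 + 1) + 2))).+1 + 1));
    last by rewrite leq_add2r leq_mul.
  apply: runs_while => [i hi||i hi].
  - by rewrite /S; at_reg => /(congr1 size); rewrite size_unary /=; lia.
  - by rewrite /S; at_reg; rewrite subnn.
  have [c1 l1] := hS' i hi.
  apply: (runs_seq (runs_pop _ _)).
  have -> : upd (S i) d.+1 (behead (S i d.+1)) = upd (S' i) d.+2 (unary i).
    have -> : S i d.+1 = unary (v - i) by rewrite /S; at_reg.
    by rewrite behead_unary -subnS /S /S'; store_eq.
  apply: (runs_seq c1).
  apply: (@runs_seq _ _ _ _ _ (gb B' * 5 + 1)).
    apply: runsW (runs_mv _ _) _; first lia.
    by rewrite upd_same size_unary; lia.
  apply: (runs_eq (runs_push _ _ _)).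
  rewrite upd_same.
  have -> : upd (upd (S' i) d.+2 (unary i)) d.+3 (unary (F i)) d = unary (P i).
    by rewrite /S'; at_reg.
  set X := (X in true :: X).
  have -> : X = unary i by rewrite /X; at_reg.
  rewrite unaryS rev_unary_cat; clear X; rewrite /S /P big_ord_recr /= -/(P i) /S'.
  by store_eq; rewrite cl //; lia.
apply: (runs_seq c2).
apply: runsW (runs_eq (runs_clear _ _) _) _.
  by rewrite /S subnn; store_eq; rewrite cl //; lia.
by rewrite /S upd_same size_unary; lia.
Qed.

Lemma comp_ok e : exists2 g, polyb g & comp_spec e g.
Proof.
elim: e => [i|n||e [g pg h]|a [ga pa ha] b [gb pb hb]|a [ga pa ha] b [gb pb hb]
  |a [ga pa ha] b [gb pb hb]|a [ga pa ha] b [gb pb hb]].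
- by eexists; last exact: comp_var; pb.
- by eexists; last exact: comp_cst; pb.
- by eexists; last exact: comp_size; pb.
- by eexists; last exact: (comp_bit h); pb.
- by eexists; last exact: (comp_add ha hb); pb.
- eexists; last exact: (comp_mul ha hb).
  apply: polyb_le (_ : polyb (fun B => ga B + (gb B +
    ((ga B * (((gb B * 12 + 2) + ((gb B * 5 + 1) + 1)) + 1) + 1) + (gb B * 2 + 1))))) _.
    pb.
  by move=> B; rewrite !addn1.
- eexists; last exact: (comp_leq ha hb).
  apply: polyb_le (_ : polyb (fun B => ga B + (gb B + ((gb B * 3 + 1) + (ga B * 2 + 3))))) _.
    pb.
  by move=> B; lia.
- eexists; last exact: (comp_sum ha hb).
  have pc : polyb (fun B => gb (B + ga B)) by apply: (polyb_comp (h := fun B => B + ga B)); pb.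
  apply: polyb_le (_ : polyb (fun B => ga B +
    ((ga B * ((1 + (gb (B + ga B) + ((gb (B + ga B) * 5 + 1) + 2))) + 1) + 1)
     + (ga B * 2 + 1)))) _.
    pb.
  by move=> B; rewrite !addn1.
Qed.

Inductive wexpr :=
| WBit of expr
| WCat of wexpr & wexpr
| WFor of expr & wexpr.

Fixpoint weval (w : word) (env : seq nat) (x : wexpr) : word :=
  match x with
  | WBit e => [:: 0 < eval w env e]
  | WCat a b => weval w env a ++ weval w env b
  | WFor e a => flatten [seq weval w (rcons env i) a | i <- iota 0 (eval w env e)]
  end.

Fixpoint wcomp (d : nat) (rho : seq nat) (x : wexpr) : cmd :=
  match x with
  | WBit e => Seq (comp d rho e)
      (Seq (If d isSome (Push 1 true) (Push 1 false)) (clear d))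
  | WCat a b => Seq (wcomp d rho a) (wcomp d rho b)
  | WFor e a => Seq (comp d rho e)
      (Seq (While d (Seq (Pop d)
              (Seq (wcomp d.+2 (rcons rho d.+1) a) (Push d.+1 true))))
        (clear d.+1))
  end.

(* The output register is filled from the front, hence in reverse. *)
Definition wcomp_spec (x : wexpr) (g : nat -> nat) : Prop :=
  forall d rho env s B, frame rho env d s B ->
    runs (wcomp d rho x) s (upd s 1 (rev (weval (s 0) env x) ++ s 1)) (g B) /\
    size (weval (s 0) env x) <= g B.

Lemma wcomp_ok x : exists2 g, polyb g & wcomp_spec x g.
Proof.
elim: x => [e|a [ga pa ha] b [gb pb hb]|e a [ga pa ha]].
- have [g pg h] := comp_ok e.
  exists (fun B => g B + (3 + (g B * 2 + 1))); first pb.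
  move=> d rho env s B /[dup] f [d1 cl sz hv [b1 b2]] /=.
  have [r1 l1] := h _ _ _ _ _ f; set v := eval _ _ _ in r1 l1 *.
  split; last lia.
  apply: (runs_seq r1).
  apply: (@runs_seq _ _ _ (upd (upd s d (unary v)) 1 ((0 < v) :: s 1))).
    apply: runs_if; rewrite upd_same.
    case: (v) => [|v'] /=; apply: (runs_eq (runs_push _ _ _));
      by rewrite upd_neq //; lia.
  apply: runsW (runs_eq (runs_clear _ _) _) _.
    by store_eq; subst; rewrite cl //; lia.
  by at_reg; rewrite size_unary; lia.
- exists (fun B => ga B + gb B); first pb.
  move=> d rho env s B f /=.
  have [ra la] := ha _ _ _ _ _ f.
  have [rb lb] := hb _ _ _ _ _ (frame_out (rev (weval (s 0) env a) ++ s 1) f).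
  rewrite upd_neq // in rb lb; rewrite upd_same in rb.
  split; last by rewrite size_cat leq_add.
  apply: (runs_eq (runs_seq ra rb)).
  by rewrite rev_cat catA; store_eq.
- have [ge pe he] := comp_ok e.
  exists (fun B => ge B + ((ge B * ((1 + (ga (B + ge B) + 2)) + 1) + 1) + (ge B * 2 + 1))).
    have pc : polyb (fun B => ga (B + ge B)).
      by apply: (polyb_comp (h := fun B => B + ge B)); pb.
    pb.
  move=> d rho env s B /[dup] f [d1 cl sz hv [b1 b2]] /=.
  have [r1 l1] := he _ _ _ _ _ f; set v := eval _ _ _ in r1 l1 *.
  set B' := B + ge B.
  pose F i := weval (s 0) (rcons env i) a.
  pose P i := flatten [seq F j | j <- iota 0 i].
  have PS i : P i.+1 = P i ++ F i.
    by rewrite /P -addn1 iotaD map_cat flatten_cat /= cats0.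
  pose S i := upd (upd (upd s 1 (rev (P i) ++ s 1)) d (unary (v - i))) d.+1 (unary i).
  pose S' i := upd (upd (upd s 1 (rev (P i) ++ s 1)) d (unary (v - i.+1))) d.+1 (unary i).
  have hS' i : i < v -> runs (wcomp d.+2 (rcons rho d.+1) a) (S' i)
      (upd (S' i) 1 (rev (F i) ++ (rev (P i) ++ s 1))) (ga B') /\ size (F i) <= ga B'.
    move=> hi.
    have fr : frame (rcons rho d.+1) (rcons env i) d.+2 (S' i) B'.
      apply: frame_bind; first by rewrite /B'; lia.
      by apply: frameS; apply: frame_out; apply: frameW f; rewrite /B' leq_addr.
    have := ha _ _ _ _ _ fr.
    have -> : S' i 0 = s 0 by rewrite /S'; at_reg.
    by have -> : S' i 1 = rev (P i) ++ s 1 by rewrite /S'; at_reg.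
  split; last first.
    have hP i : i <= v -> size (P i) <= i * ga B'.
      elim: i => // i IH hi; rewrite PS size_cat mulSn addnC.
      by apply: leq_add; [have [] := hS' i hi | apply: IH; lia].
    have h2 : v * ga B' <= ge B * ga B' by rewrite leq_mul.
    by have h1 := hP v (leqnn _); rewrite -/(P v) -/B' !mulnDr; lia.
  apply: (runs_seq r1).
  have -> : upd s d (unary v) = S 0.
    by rewrite /S !subn0 /P /=; store_eq; subst => //; apply: cl; lia.
  have c2 : runs (While d (Seq (Pop d)
              (Seq (wcomp d.+2 (rcons rho d.+1) a) (Push d.+1 true))))
      (S 0) (S v) (ge B * ((1 + (ga B' + 2)) + 1) + 1).
    apply: (@runsW _ _ _ (v * (1 + (ga B' + 2)).+1 + 1));
      last by rewrite leq_add2r leq_mul // addn1.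
    apply: runs_while => [i hi||i hi].
    - by rewrite /S; at_reg => /(congr1 size); rewrite size_unary /=; lia.
    - by rewrite /S; at_reg; rewrite subnn.
    have [c1 _] := hS' i hi.
    apply: (runs_seq (runs_pop _ _)).
    have -> : upd (S i) d (behead (S i d)) = S' i.
      have -> : S i d = unary (v - i) by rewrite /S; at_reg.
      by rewrite behead_unary -subnS /S /S'; store_eq.
    apply: (runs_seq c1); apply: (runs_eq (runs_push _ _ _)).
    have -> : upd (S' i) 1 (rev (F i) ++ (rev (P i) ++ s 1)) d.+1 = unary i.
      by rewrite /S'; at_reg.
    by rewrite unaryS /S PS rev_cat catA /S'; store_eq.
  apply: (runs_seq c2).
  apply: runsW (runs_eq (runs_clear _ _) _) _.
    by rewrite /S subnn; store_eq; subst; rewrite cl //; lia.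
  by rewrite /S upd_same size_unary; lia.
Qed.

Theorem polytime_weval x : polytime (fun w => weval w [::] x).
Proof.
have [g pg h] := wcomp_ok x.
have [k hk] : polyb (fun B => g B + ((B * 2 + 1) + (g B * 5 + 1))) by pb.
(* The output is left reversed in register 1; moving it onto the cleared register 0 reverses it once
   more. *)
apply: (@exec_polytime (Seq (wcomp 2 [::] x) (Seq (clear 0) (mv 1 0))) _ k) => w.
have fr : frame [::] [::] 2 (init_store w) (size w).
  split=> //; first by case=> [|[|r]].
  by split=> // i; rewrite nth_nil.
have [r1 l1] := h _ _ _ _ _ fr.
rewrite /= cats0 in r1 l1.
pose s1 := upd (init_store w) 1 (rev (weval w [::] x)).
have r2 : runs (clear 0) s1 (upd s1 0 [::]) (size w * 2 + 1) by apply: runs_clear.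
have l3 : size (upd s1 0 [::] 1) * 5 + 1 <= g (size w) * 5 + 1.
  by rewrite /s1 upd_neq // upd_same size_rev leq_add2r leq_mul2r l1.
have r3 := runsW (@runs_mv 1 0 (upd s1 0 [::]) isT) l3.
have [n ln ex] := runs_seq r1 (runs_seq r2 r3).
exists n; eexists; split; first exact: ex.
  rewrite upd_same upd_neq // upd_same cats0.
  by rewrite /s1 upd_same revK.
exact: leq_trans ln (hk _).
Qed.

(** * Identifications as quotient maps *)

(** Fibres may be disconnected, since any two vertices can be identified. Edges inside a fibre
    disappear, hence the condition [a != b]. *)
Definition quotient_map (G H : sgraph) (f : G -> H) : Prop :=
  (forall a, exists x, f x = a) /\
  (forall a b, a != b ->
     adj a b <-> exists x y, [/\ f x = a, f y = b & adj x y]).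

Definition merge (G : sgraph) (u v : G) (x : G) : identify u v := insub x.

Lemma merge_val (G : sgraph) (u v : G) (y : {x : G | (x != u) && (x != v)}) :
  merge u v (val y) = Some y.
Proof. exact: valK. Qed.

Lemma merge_None (G : sgraph) (u v x : G) :
  (merge u v x == None) = (x == u) || (x == v).
Proof.
rewrite /merge; case: insubP => [y h _|]; last by rewrite negb_and !negbK => ->.
by apply/esym/negbTE; rewrite negb_or.
Qed.

Lemma identify_adjP (G : sgraph) (u v : G) (z z' : identify u v) : z != z' ->
  adj z z' <-> exists x y, [/\ merge u v x = z, merge u v y = z' & adj x y].
Proof.
have mu : merge u v u = None by apply/eqP; rewrite merge_None eqxx.
have mv' : merge u v v = None by apply/eqP; rewrite merge_None eqxx orbT.
move=> ne; split.
  case: z z' ne => [x|] [y|] //= _.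
  - by move=> h; exists (val x), (val y); rewrite !merge_val.
  - by case/orP=> h; [exists (val x), u | exists (val x), v];
      rewrite merge_val adj_sym; split.
  - by case/orP=> h; [exists u, (val y) | exists v, (val y)];
      rewrite merge_val; split.
move=> [x [y [ex ey h]]]; move: ne; rewrite -ex -ey {ex ey} /merge.
case: insubP => [a _ ea|]; case: insubP => [b _ eb|] //=.
- by rewrite ea eb.
- rewrite negb_and !negbK ea => /orP[]/eqP e; subst y;
    by rewrite adj_sym in h; rewrite h ?orbT.
- by rewrite negb_and !negbK eb => /orP[]/eqP e; subst x; rewrite h ?orbT.
Qed.

(** Forwards, the maps [merge] of the successive steps are composed. Backwards, by induction on the
    number of vertices: an injective quotient map is an isomorphism, and any other has two vertices
    in one fibre and factors through their identification. *)
Lemma identifies_toP G H :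
  identifies_to G H <-> exists f : G -> H, quotient_map f.
Proof.
split.
  elim=> {G H} [G H [f [g fK gK] hf]|G H u v uv _ [f [sf hf]]].
    exists f; split=> [a|a b ab]; first by exists (g a).
    split=> [h|[x [y [<- <- h]]]]; last by rewrite hf.
    by exists (g a), (g b); rewrite !gK -hf !gK.
  exists (f \o merge u v); split=> [a|a b ab].
    have [[y|] e] := sf a; first by exists (val y); rewrite /= merge_val.
    by exists u; rewrite /= -e; congr f; apply/eqP; rewrite merge_None eqxx.
  rewrite hf //; split.
    move=> [z [z' [ez ez' h]]].
    have ne : z != z' by apply: contra_neq ab => e; rewrite -ez -ez' e.
    have [x [y [ex ey h']]] := (identify_adjP ne).1 h.
    by exists x, y; rewrite /= ex ey.
  move=> [x [y [/= ex ey h]]]; exists (merge u v x), (merge u v y); split=> //.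
  have ne : merge u v x != merge u v y.
    by apply: contra_neq ab => e; rewrite -ex -ey e.
  by apply/(identify_adjP ne); exists x, y.
move=> [f]; move: {2}#|G|.+1 (ltnSn #|G|) => n.
elim: n G f => [//|n IH] G f hn [sf hf].
have [fi|/injectivePn [u [v uv e]]] := boolP (injectiveb f).
  apply: Identify_done; exists f.
    have sf' a : exists x, f x == a by have [x <-] := sf a; exists x.
    have gK : cancel (fun a => xchoose (sf' a)) f.
      by move=> a; apply/eqP/(xchooseP (sf' a)).
    by exists (fun a => xchoose (sf' a)) => //; apply: inj_can_sym gK (injectiveP _ fi).
  move=> x y; have [->|xy] := eqVneq x y; first by rewrite !adj_irr.
  have ne : f x != f y by rewrite (inj_eq (injectiveP _ fi)).
  apply/idP/idP => [/(hf _ _ ne) [x' [y' [/(injectiveP _ fi) -> /(injectiveP _ fi) ->]]]//|h].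
  by apply/(hf _ _ ne); exists x, y.
apply: (Identify_step uv).
pose f' (z : identify u v) := if z is Some x then f (val x) else f u.
have ff x : f' (merge u v x) = f x.
  rewrite /merge; case: insubP => [y _ <- //|].
  by rewrite negb_and !negbK => /orP[]/eqP ->.
apply: (IH _ f').
  have := cardC (pred2 u v); rewrite card2 uv /= => hc.
  rewrite card_option card_sig (leq_trans _ (hn : #|G| <= n)) //.
  rewrite -hc addSn add1n !ltnS; apply: subset_leq_card.
  by apply/subsetP => x; rewrite !inE negb_or.
split=> [a|a b ab].
  by have [x ex] := sf a; exists (merge u v x); rewrite ff.
rewrite hf //; split.
  move=> [x [y [ex ey h]]]; exists (merge u v x), (merge u v y); rewrite !ff; split=> //.
  have ne : merge u v x != merge u v y.
    by apply: contra_neq ab => e'; rewrite -ex -ey -ff e' ff.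
  by apply/(identify_adjP ne); exists x, y.
move=> [z [z' [ez ez' h]]].
have ne : z != z' by apply: contra_neq ab => e'; rewrite -ez -ez' e'.
have [x [y [ex ey h']]] := (identify_adjP ne).1 h.
by exists x, y; rewrite -!ff ex ey.
Qed.

(** * Split interval graphs with two simplicial vertices *)

Lemma interval_graph_nat (G : sgraph) (l r : G -> nat) :
  (forall x, l x <= r x) ->
  (forall x y, x != y -> adj x y = (l x <= r y) && (l y <= r x)) ->
  interval_graph G.
Proof.
move=> lr h; exists (fun x => `[(l x)%:R, (r x)%:R]%R) => x y /h ->.
split=> [/andP[h1 h2]|[z]].
  exists (maxn (l x) (l y))%:R%R.
  by rewrite !in_itv /= !Num.Theory.ler_nat leq_maxl leq_maxr !geq_max !lr h1 h2.
rewrite !in_itv /= => /andP[/andP[a1 a2] /andP[b1 b2]].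
by rewrite -!(Num.Theory.ler_nat R) (Order.POrderTheory.le_trans a1 b2)
           (Order.POrderTheory.le_trans b1 a2).
Qed.

Lemma cliqueP (G : sgraph) (K : {set G}) :
  reflect {in K &, forall x y, x != y -> adj x y} (clique K).
Proof.
apply: (iffP forall_inP) => [h x y hx hy xy|h x hx].
  by have /forall_inP /(_ y hy) /implyP := h x hx; apply.
by apply/forall_inP => y hy; apply/implyP; apply: h.
Qed.

Lemma simplicialP (G : sgraph) (a : G) :
  reflect (forall x y, adj a x -> adj a y -> x != y -> adj x y) (simplicial a).
Proof.
apply: (iffP (cliqueP _)) => h x y; first by move=> hx hy; apply: h; rewrite inE.
by rewrite !inE; apply: h.
Qed.

(** This form of the class quantifies over vertices only, so a bounded formula can express it. *)
Definition clique_and_two (H : sgraph) (u v : H) : Prop :=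
  [/\ u != v, forall x, simplicial x = (x == u) || (x == v) &
      forall x y, x != u -> x != v -> y != u -> y != v -> x != y -> adj x y].

(* If [u] and [v] are adjacent then they have the same neighbours, and any
   further vertex would produce a third simplicial one. *)
Lemma clique_and_two_adj (H : sgraph) (u v : H) : clique_and_two u v ->
  adj u v -> forall w, w = u \/ w = v.
Proof.
move=> [uv hs hc] auv w.
have su : simplicial u by rewrite hs eqxx.
have sv : simplicial v by rewrite hs eqxx orbT.
have avu : adj v u by rewrite adj_sym.
have hN x : x != u -> x != v -> adj x u = adj x v.
  move=> xu xv; apply/idP/idP => h; rewrite adj_sym.
    by apply: (simplicialP _ su) => //; rewrite 1?eq_sym // adj_sym.
  by apply: (simplicialP _ sv) => //; rewrite 1?eq_sym // adj_sym.
(* A vertex that misses [u] also misses [v] by [hN], so its neighbourhood lies in the remaining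
   clique and it would be a third simplicial vertex. *)
have far x : x != u -> x != v -> adj x u.
  move=> xu xv; apply: contraT => nxu.
  have : simplicial x.
    apply/simplicialP => y z hy hz yz.
    have ny : forall y, adj x y -> (y != u) && (y != v).
      move=> t ht; apply/andP; split; apply: contraNneq nxu => e; first by rewrite -e.
      by rewrite hN // -e.
    have [/andP[y1 y2] /andP[z1 z2]] := (ny _ hy, ny _ hz).
    exact: hc.
  by rewrite hs (negbTE xu) (negbTE xv).
have all (x y : H) : x != y -> adj x y.
  have pre z : z != u -> adj z u.
    move=> zu; have [->//|zv] := eqVneq z v; exact: far.
  have prv z : z != v -> adj z v.
    move=> zv; have [->//|zu] := eqVneq z u; rewrite -hN //; exact: far.
  have [->|xu] := eqVneq x u; first by rewrite eq_sym adj_sym; apply: pre.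
  have [->|xv] := eqVneq x v; first by rewrite eq_sym adj_sym; apply: prv.
  have [->|yu] := eqVneq y u; first by move=> _; apply: pre.
  have [->|yv] := eqVneq y v; first by move=> _; apply: prv.
  exact: hc.
have : simplicial w by apply/simplicialP => x y _ _; apply: all.
by rewrite hs => /orP[]/eqP ->; [left | right].
Qed.

Lemma split_interval_two_simplicialP (H : sgraph) :
  [/\ split_graph H, interval_graph H & #|[set v : H | simplicial v]| = 2] <->
  exists u v : H, clique_and_two u v.
Proof.
split=> [[[K /andP[/cliqueP cK /forall_inP iK]] _ /eqP /cards2P [u [v [uv e]]]]|].
  have hs x : simplicial x = (x == u) || (x == v).
    by have := in_set2 x u v; rewrite -e inE.
  (* A vertex outside [K] has all its neighbours in the clique [K] and is therefore simplicial. *)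
  have hK x : x != u -> x != v -> x \in K.
    move=> xu xv; apply: contraT => nK.
    suff : simplicial x by rewrite hs (negbTE xu) (negbTE xv).
    have inK y : adj x y -> y \in K.
      move=> hy; apply: contraLR hy => ny.
      have /iK /forall_inP h : x \in ~: K by rewrite inE.
      by apply: h; rewrite inE.
    by apply/simplicialP => y z hy hz; apply: cK; apply: inK.
  by exists u, v; split=> // x y *; apply: cK => //; apply: hK.
move=> [u [v /[dup] hcl [uv hs hc]]].
have card2 : #|[set v : H | simplicial v]| = 2.
  rewrite (_ : [set _ | _] = [set u; v]) ?cards2 ?uv //.
  by apply/setP => x; rewrite !inE hs.
have [auv|nauv] := boolP (adj u v).
  have two := clique_and_two_adj hcl auv.
  have all (x y : H) : x != y -> adj x y.
    by case: (two x) => ->; case: (two y) => ->; rewrite ?eqxx // adj_sym.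
  split=> //.
    exists setT; apply/andP; split; first by apply/cliqueP => x y _ _; apply: all.
    by apply/forall_inP => x; rewrite !inE.
  by apply: (@interval_graph_nat _ (fun=> 0) (fun=> 0)) => // x y /all ->.
have nvu : ~~ adj v u by rewrite adj_sym.
split=> //.
  exists (~: [set u; v]); apply/andP; split.
    apply/cliqueP => x y; rewrite !inE !negb_or => /andP[a1 a2] /andP[b1 b2].
    exact: hc.
  rewrite setCK; apply/forall_inP => x; rewrite !inE => hx.
  apply/forall_inP => y; rewrite !inE => hy.
  by case/orP: hx => /eqP ->; case/orP: hy => /eqP ->; rewrite ?adj_irr.
(* The vertices [u] and [v] become the points 0 and 2. All other intervals contain 1, and they are
   extended to 0 or to 2 exactly when the vertex is adjacent to [u] or to [v]. *)
pose l x := if x == u then 0 else if x == v then 2 else if adj x u then 0 else 1.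
pose r x := if x == u then 0 else if x == v then 2 else if adj x v then 2 else 1.
apply: (@interval_graph_nat _ l r) => x; rewrite /l /r.
  by do 4?case: ifP.
move=> y; have vu : (v == u) = false by rewrite eq_sym (negbTE uv).
have [->|xu] := eqVneq x u.
  rewrite eq_sym => /negbTE ->; have [->|yv] := eqVneq y v.
    by rewrite (negbTE nauv).
  by rewrite adj_sym; case: ifP; case: ifP.
have [->|xv] := eqVneq x v.
  rewrite eq_sym => /negbTE ->; have [->|yu] := eqVneq y u.
    by rewrite (negbTE nvu).
  by rewrite [adj v y]adj_sym; case: (adj y v); case: (adj y u).
have [->|yu] := eqVneq y u; first by case: (adj x u); case: (adj x v).
have [->|yv] := eqVneq y v; first by case: (adj x u); case: (adj x v).
move=> xy; rewrite hc //.
by case: (adj x u); case: (adj x v); case: (adj y u); case: (adj y v).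
Qed.

(** * Complete graphs minus an edge and hypergraph 2-colouring *)

Definition cpe_adj (k : nat) : rel 'I_k.+2 :=
  fun i j => (val i != val j) && (val i + val j != 1).

Lemma cpe_sym k : symmetric (@cpe_adj k).
Proof. by move=> i j; rewrite /cpe_adj eq_sym addnC. Qed.

Lemma cpe_irr k : irreflexive (@cpe_adj k).
Proof. by move=> i; rewrite /cpe_adj eqxx. Qed.

(** The missing edge joins 0 and 1, the only distinct numbers with sum 1. *)
Definition clique_minus_edge (k : nat) : sgraph := SGraph (@cpe_sym k) (@cpe_irr k).

Lemma cme_eqE k (x y : clique_minus_edge k) :
  (x == y) = (nat_of_ord x == nat_of_ord y).
Proof. by rewrite -val_eqE. Qed.

Lemma cme_adjE k (x y : clique_minus_edge k) : adj x y =
  (nat_of_ord x != nat_of_ord y) && (nat_of_ord x + nat_of_ord y != 1).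
Proof. by []. Qed.

Lemma clique_minus_edge_class k : 0 < k ->
  let H := clique_minus_edge k in
  [/\ split_graph H, interval_graph H & #|[set v : H | simplicial v]| = 2].
Proof.
move=> k0; apply/split_interval_two_simplicialP.
pose i1 : 'I_k.+2 := inord 1.
have v1 : nat_of_ord i1 = 1 by rewrite inordK.
exists (ord0 : 'I_k.+2), i1; split.
- by rewrite cme_eqE v1.
- move=> x; rewrite !cme_eqE v1.
  apply/simplicialP/idP => [h|h y z]; last first.
    by move: h; rewrite !cme_adjE cme_eqE /=; lia.
  (* A vertex other than 0 and 1 is adjacent to both ends of the missing edge, so it is not
     simplicial. *)
  have := h ord0 i1; rewrite !cme_adjE cme_eqE v1 /=; lia.
- by move=> x y; rewrite !cme_eqE cme_adjE v1 /=; lia.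
Qed.

(** The neighbours outside [E] of a vertex of [E] form a hyperedge, and both colours must occur on
    it. *)
Definition splitting (G : sgraph) (E : pred G) (col : G -> bool) : Prop :=
  forall e b, E e -> exists2 x, ~~ E x & adj e x && (col x == b).

Lemma identifies_splitting (G : sgraph) (E : pred G) :
  0 < #|E| ->
  (forall x y, E x -> E y -> x != y -> adj x y) ->
  (forall x y, ~~ E x -> ~~ E y -> ~~ adj x y) ->
  identifies_to G (clique_minus_edge #|E|) <-> exists col, splitting E col.
Proof.
set k := #|E| => k0 hE hX; rewrite identifies_toP.
pose i1 : clique_minus_edge k := inord 1 : 'I_k.+2.
pose i0 : clique_minus_edge k := ord0.
have v1 : nat_of_ord i1 = 1 by rewrite inordK.
have n01 : i0 != i1 by rewrite cme_eqE v1.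
split=> [[f [sf hf]]|[col hcol]].
  (* [C] collects the vertices whose fibres contain no hyperedge. Such fibres are pairwise
     non-adjacent, which leaves only 0 and 1 for two distinct members of [C]. *)
  pose C := ~: (f @: [set x | E x]).
  have CX x : f x \in C -> ~~ E x.
    by rewrite inE; apply: contraNN => h; apply/imsetP; exists x; rewrite ?inE.
  have hC a b : a \in C -> b \in C -> a != b ->
      nat_of_ord a + nat_of_ord b = 1.
    move=> ha hb ab; apply/eqP; apply: contraT => h.
    have : adj a b by rewrite cme_adjE h -cme_eqE ab.
    move/(hf _ _ ab) => [x [y [ex ey]]]; apply: contraLR => _.
    by apply: hX; apply: CX; rewrite ?ex ?ey.
  have cI : #|f @: [set x | E x]| <= k by rewrite (leq_trans (leq_imset_card _ _)) ?cardsE.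
  (* The target has [k + 2] vertices, of which at most [k] are images of hyperedges. *)
  have cC : 1 < #|C|.
    have := cardsC (f @: [set x | E x]); rewrite card_ord -/C; lia.
  have [a [b [ha hb ab]]] := card_gt1P cC.
  have h0 : i0 \in C /\ i1 \in C.
    have := hC _ _ ha hb ab.
    case va : (nat_of_ord a) => [|[|n]] // h.
      have -> : i0 = a by apply: ord_inj.
      by have -> : i1 = b by apply: ord_inj; rewrite v1; lia.
    have -> : i1 = a by apply: ord_inj; rewrite v1.
    by have -> : i0 = b by apply: ord_inj => /=; lia.
  have C2 : C = [set i0; i1].
    apply/setP => c; rewrite !inE; apply/idP/idP => [hc|/orP[]/eqP ->]; last 2 first.
    - by have [] := h0; rewrite inE.
    - by have [] := h0; rewrite !inE.
    have hc' : c \in C by rewrite inE.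
    have [//|c0] := eqVneq c i0; have [//|c1] := eqVneq c i1.
    have := hC _ _ hc' h0.1 c0; have := hC _ _ hc' h0.2 c1.
    by rewrite v1 /=; lia.
  (* As [C] has exactly two elements, the [k] hyperedges have [k] distinct images. *)
  have fi : {in [set x | E x] &, injective f}.
    apply/imset_injP/eqP.
    have := cardsC (f @: [set x | E x]); rewrite card_ord -/C C2 cards2 n01 cardsE -/k; lia.
  (* The edge between [f e] and [c] comes from an edge of [G]. Its end over [c] is a point, so its
     other end is a hyperedge, and that is [e] by injectivity. *)
  have wit e c : E e -> c \in C -> exists2 x, ~~ E x & adj e x && (f x == c).
    move=> he hc.
    have fe : f e \notin C by rewrite inE negbK; apply/imsetP; exists e; rewrite ?inE.
    have ne : f e != c by apply: contraNneq fe => ->.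
    have : adj (f e) c.
      move: fe hc ne; rewrite C2 !inE cme_adjE !cme_eqE v1 /=; lia.
    move/(hf _ _ ne) => [y [x [ey ex h]]].
    have nx : ~~ E x by apply: CX; rewrite ex.
    exists x => //; rewrite ex eqxx andbT.
    have Ey : E y by apply: contraLR h => ny; apply: hX.
    by rewrite -(fi y e) // inE.
  exists (fun x => f x == i0) => e c he; case: c.
    by have [x h1 h2] := wit e i0 he h0.1; exists x => //; move: h2; case: eqP.
  have [x h1 /andP[h2 /eqP h3]] := wit e i1 he h0.2; exists x => //.
  by rewrite h2 h3 [i1 == i0]eq_sym (negbTE n01).
have /card_gt0P [e0 He0] := k0.
(* Conversely, the hyperedges are numbered from 2 on, and the points go to 0 or 1 according to their
   colour. *)
pose rk x : nat := enum_rank_in He0 x.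
have rkk x : rk x < k by apply: ltn_ord.
pose f x : clique_minus_edge k :=
  inord (if E x then (rk x).+2 else if col x then 0 else 1) : 'I_k.+2.
have vf x : nat_of_ord (f x) = if E x then (rk x).+2 else if col x then 0 else 1.
  by rewrite /f /= inordK //; have := rkk x; do ?case: ifP => _; lia.
have fE e : E e -> nat_of_ord (f e) = (rk e).+2 by rewrite vf => ->.
have fX x b : ~~ E x -> col x == b -> nat_of_ord (f x) = (~~ b).
  by rewrite vf => /negbTE -> /eqP ->; case: b.
have pre (a : clique_minus_edge k) : 1 < nat_of_ord a -> exists2 e, E e & f e = a.
  move=> ha; have hk : nat_of_ord a - 2 < k by have := ltn_ord a; rewrite /=; lia.
  pose e := enum_val (Ordinal hk : 'I_#|E|).
  have he : E e by apply: (enum_valP (Ordinal hk)).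
  exists e => //; apply: ord_inj; rewrite fE // /rk /e enum_valK_in /=; lia.
exists f; split=> [a|a b].
  have [ha|ha] := ltnP 1 (nat_of_ord a); first by have [e _ <-] := pre a ha; exists e.
  have [x h1 /andP[_ h2]] := hcol e0 (nat_of_ord a == 0) He0.
  exists x; apply: ord_inj; rewrite (fX _ _ h1 h2) /=.
  by move: ha; rewrite /=; case: (nat_of_ord a) => [|[|]].
(* Of two adjacent vertices of the target the larger one exceeds 1, so it is the image of a
   hyperedge. *)
wlog: a b / nat_of_ord b <= nat_of_ord a => [hw|ba] ab.
  have [h|/ltnW h] := leqP (nat_of_ord b) (nat_of_ord a); first exact: hw.
  rewrite adj_sym; rewrite hw // 1?eq_sym //.
  by split=> -[x [y [h1 h2 h3]]]; exists y, x; rewrite adj_sym.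
split=> [|[x [y [<- <- h]]]]; last first.
  apply: contraT => na.
  have xy : x != y by apply: contraTneq h => ->; rewrite adj_irr.
  move: na; rewrite cme_adjE negb_and !negbK.
  have [Ex|nEx] := boolP (E x); have [Ey|nEy] := boolP (E y).
  - rewrite !fE // => /orP[/eqP []|/eqP]; last by rewrite !addSn addnS.
    move/ord_inj/(enum_rank_in_inj Ex Ey) => e.
    by rewrite e eqxx in xy.
  - by rewrite (fE x) // (fX y (col y)) //; case: (col y) => /=; lia.
  - by rewrite (fE y) // (fX x (col x)) //; case: (col x) => /=; lia.
  - by rewrite (negbTE (hX _ _ nEx nEy)) in h.
move=> hab; have ha : 1 < nat_of_ord a.
  move: hab ba; rewrite cme_adjE; case: (nat_of_ord a) => [|[|]] //; lia.
have [e he ea] := pre a ha.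
have [hb|hb] := ltnP 1 (nat_of_ord b).
  have [e' he' eb] := pre b hb; exists e, e'; split=> //; apply: hE => //.
  by apply: contra_neq ab => E'; rewrite -ea -eb E'.
have [x h1 /andP[h2 h3]] := hcol e (nat_of_ord b == 0) he.
exists e, x; split=> //; apply: ord_inj; rewrite (fX _ _ h1 h3).
by move: hb; rewrite /=; case: (nat_of_ord b) => [|[|]].
Qed.

(** * Bounded formulas *)

Inductive form :=
| FBool of bool
| FLe of expr & expr
| FEq of expr & expr
| FBit of expr
| FNot of form
| FAnd of form & form
| FOr of form & form
| FImp of form & form
| FAll of expr & form
| FEx of expr & form.

(** The specifications below copy the shape of its unfolding, so that most of the correspondence
    with formulas holds by computation. *)
Fixpoint sem (w : word) (env : seq nat) (p : form) : Prop :=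
  match p with
  | FBool b => b
  | FLe a b => eval w env a <= eval w env b
  | FEq a b => eval w env a = eval w env b
  | FBit e => nth false w (eval w env e)
  | FNot p => ~ sem w env p
  | FAnd p q => sem w env p /\ sem w env q
  | FOr p q => sem w env p \/ sem w env q
  | FImp p q => sem w env p -> sem w env q
  | FAll e p => forall i, i < eval w env e -> sem w (rcons env i) p
  | FEx e p => exists2 i, i < eval w env e & sem w (rcons env i) p
  end.

Definition enot (e : expr) : expr := Leq e (Cst 0).

(** Truth is positivity rather than the value 1, so that disjunctions and existential quantifiers
    become sums. *)
Fixpoint expr_of (p : form) : expr :=
  match p with
  | FBool b => Cst b
  | FLe a b => Leq a b
  | FEq a b => Mul (Leq a b) (Leq b a)
  | FBit e => Bit e
  | FNot p => enot (expr_of p)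
  | FAnd p q => Mul (expr_of p) (expr_of q)
  | FOr p q => Add (expr_of p) (expr_of q)
  | FImp p q => Add (enot (expr_of p)) (expr_of q)
  | FAll e p => enot (Sum e (enot (expr_of p)))
  | FEx e p => Sum e (expr_of p)
  end.

Lemma not_gt0E n : (0 < (n <= 0)) = ~~ (0 < n).
Proof. by case: n. Qed.

Lemma sum_gt0P n (F : nat -> nat) :
  reflect (exists2 i, i < n & 0 < F i) (0 < \sum_(i < n) F i).
Proof.
rewrite lt0n sum_nat_eq0 negb_forall.
apply: (iffP existsP) => [[i]|[i hi h]].
  by rewrite /= -lt0n => h; exists i.
by exists (Ordinal hi); rewrite /= -lt0n.
Qed.

Lemma sem_iff w env p : sem w env p <-> 0 < eval w env (expr_of p).
Proof.
elim: p env => [b|a b|a b|e|p IH|p IHp q IHq|p IHp q IHq|p IHp q IHq|e p IH|e p IH] env /=.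
- by rewrite lt0b.
- by rewrite lt0b.
- rewrite muln_gt0 !lt0b -eqn_leq; split=> [->//|/eqP]; exact.
- by rewrite lt0b.
- by rewrite IH not_gt0E; split=> /negP.
- by rewrite IHp IHq muln_gt0; split=> [[-> ->]|/andP].
- by rewrite IHp IHq addn_gt0; split=> /orP.
- by rewrite IHp IHq addn_gt0 not_gt0E -implybE; split=> /implyP.
- pose F i : nat := eval w (rcons env i) (expr_of p) <= 0.
  rewrite not_gt0E; split=> [h|/negP h i hi].
    apply/negP => /(sum_gt0P _ F) [i hi].
    by rewrite not_gt0E => /negP; apply; apply/IH/h.
  apply/IH; apply: contraT => h'; case: h; apply/(sum_gt0P _ F); exists i => //.
  by rewrite /F not_gt0E.
- pose F i := eval w (rcons env i) (expr_of p).
  split=> [[i hi /IH h]|/(sum_gt0P _ F) [i hi /IH h]]; last by exists i.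
  by apply/(sum_gt0P _ F); exists i.
Qed.

(** * Codes of graphs *)

Lemma pair_word_cons b x y : pair_word (b :: x) y = true :: b :: pair_word x y.
Proof. by []. Qed.

Lemma size_pair_word x y : size (pair_word x y) = 2 * size x + 1 + size y.
Proof. by elim: x => [|b x IH] //; rewrite pair_word_cons /= IH; lia. Qed.

Lemma nth_pair_even x y i : i < size x -> nth false (pair_word x y) (2 * i).
Proof.
elim: x i => [|b x IH] [|i] // hi.
by rewrite pair_word_cons mulnS; apply: IH.
Qed.

Lemma nth_pair_sep x y : nth false (pair_word x y) (2 * size x) = false.
Proof. by elim: x => [|b x IH] //; rewrite pair_word_cons [size _]/= mulnS. Qed.

Lemma nth_pair_odd x y i : i < size x ->
  nth false (pair_word x y) (2 * i + 1) = nth false x i.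
Proof.
elim: x i => [|b x IH] [|i] // hi.
by rewrite pair_word_cons mulnS; apply: IH.
Qed.

Lemma nth_pair_right x y i :
  nth false (pair_word x y) (2 * size x + 1 + i) = nth false y i.
Proof. by elim: x => [|b x IH] //; rewrite pair_word_cons [size _]/= mulnS. Qed.

(** The first unmarked even position is the separator, and it fixes both components. *)
Lemma pair_wordE w m : 2 * m < size w ->
  (forall i, i < m -> nth false w (2 * i)) -> ~ nth false w (2 * m) ->
  w = pair_word (mkseq (fun i => nth false w (2 * i + 1)) m)
        (mkseq (fun i => nth false w (2 * m + 1 + i)) (size w - (2 * m + 1))).
Proof.
move=> hs h1 h2; apply: (@eq_from_nth _ false).
  by rewrite size_pair_word !size_mkseq; lia.
move=> i hi; set x := mkseq _ m; set y := mkseq _ _.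
have sx : size x = m by rewrite size_mkseq.
have [hlt|hge] := ltnP i (2 * m); last first.
  have [->|ne] := eqVneq i (2 * m).
    by rewrite -[in RHS]sx nth_pair_sep; apply/negP.
  have -> : i = 2 * m + 1 + (i - (2 * m + 1)) by lia.
  by rewrite -[in RHS]sx nth_pair_right sx nth_mkseq //; lia.
have := odd_double_half i; rewrite -mul2n; case: (odd i) => /= e.
  have hm : i./2 < m by lia.
  by rewrite -{2}e addnC nth_pair_odd ?sx // nth_mkseq // -{1}e addnC.
have hm : i./2 < m by lia.
by rewrite -e add0n nth_pair_even ?sx // h1.
Qed.

Lemma nth_allpairs (S T : Type) (f : S -> T -> bool) s t x0 y0 i j :
  i < size s -> j < size t ->
  nth false [seq f x y | x <- s, y <- t] (i * size t + j) =
  f (nth x0 s i) (nth y0 t j).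
Proof.
move=> hi hj; elim: s i hi => [|x s IH] [|i] //= hi.
  by rewrite nth_cat size_map hj (nth_map y0).
rewrite nth_cat size_map ifF; last by rewrite mulSn; lia.
by rewrite -IH //; congr nth; lia.
Qed.

Definition entry (n i j : nat) : nat := n + 1 + (i * n + j).

Lemma size_graph_code (G : sgraph) :
  size (graph_code G) = #|G| + 1 + #|G| * #|G|.
Proof.
by rewrite size_cat /= size_nseq size_allpairs -cardE; lia.
Qed.

Lemma nth_graph_code_ones (G : sgraph) i : i < #|G| -> nth false (graph_code G) i.
Proof. by move=> hi; rewrite nth_cat size_nseq hi nth_nseq hi. Qed.

Lemma nth_graph_code_sep (G : sgraph) : nth false (graph_code G) #|G| = false.
Proof. by rewrite nth_cat size_nseq ltnn subnn. Qed.

Lemma nth_graph_code_entry (G : sgraph) (x0 : G) i j : i < #|G| -> j < #|G| ->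
  nth false (graph_code G) (entry #|G| i j) =
  adj (nth x0 (enum G) i) (nth x0 (enum G) j).
Proof.
move=> hi hj; rewrite nth_cat size_nseq ifF; last by rewrite /entry; lia.
have -> : entry #|G| i j - #|G| = (i * #|G| + j).+1 by rewrite /entry; lia.
by rewrite [LHS]/= {1}cardE (nth_allpairs _ x0 x0) // -cardE.
Qed.

Lemma nth_graph_code_rank (G : sgraph) (x y : G) :
  nth false (graph_code G) (entry #|G| (enum_rank x) (enum_rank y)) = adj x y.
Proof. by rewrite (nth_graph_code_entry x) ?ltn_ord // !nth_enum_rank. Qed.

(** These are the conditions on a bit sequence to start with the code of a graph: the unary size
    with its separator, an empty diagonal and symmetry. *)
Definition graph_bits (n : nat) (b : nat -> bool) : Prop :=
  [/\ forall i, i < n -> b i, ~ b n, forall i, i < n -> ~ b (entry n i i) &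
      forall i, i < n -> forall j, j < n -> b (entry n i j) -> b (entry n j i)].

Lemma graph_bits_code (G : sgraph) : graph_bits #|G| (nth false (graph_code G)).
Proof.
split.
- exact: nth_graph_code_ones.
- by rewrite nth_graph_code_sep.
- move=> i hi; have x0 : G := enum_val (Ordinal hi).
  by rewrite (nth_graph_code_entry x0) // adj_irr.
- move=> i hi j hj; have x0 : G := enum_val (Ordinal hi).
  by rewrite !(nth_graph_code_entry x0) // adj_sym.
Qed.

Lemma graph_of_bits n b : graph_bits n b ->
  exists sy ir, let G := @SGraph 'I_n (fun i j => b (entry n i j)) sy ir in
    graph_code G = mkseq b (n + 1 + n * n).
Proof.
move=> [h1 h2 h3 h4].
have sy : symmetric (fun i j : 'I_n => b (entry n i j)).
  by move=> i j; apply/idP/idP; apply: h4.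
have ir : irreflexive (fun i j : 'I_n => b (entry n i j)).
  by move=> i; apply/negP/h3.
exists sy, ir => /=; set G := SGraph _ _.
have cG : #|G| = n by rewrite card_ord.
apply: (@eq_from_nth _ false); first by rewrite size_mkseq size_graph_code cG.
move=> m; rewrite size_graph_code cG => hm; rewrite nth_mkseq //.
have [hlt|hge] := ltnP m n; first by rewrite nth_graph_code_ones ?cG // h1.
have [->|ne] := eqVneq m n.
  by rewrite -{1}cG nth_graph_code_sep; apply/esym/negP.
set r := m - (n + 1).
have hr : r < n * n by rewrite /r; lia.
have n0 : 0 < n by case: (n) hr.
have hi : r %/ n < n by rewrite ltn_divLR.
have hj : r %% n < n by rewrite ltn_mod.
have -> : m = entry n (r %/ n) (r %% n).
  by rewrite /entry -divn_eq /r; lia.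
rewrite -{1}cG (@nth_graph_code_entry G (Ordinal hi)) ?cG //.
rewrite -[LHS]/(b (entry n (nth (Ordinal hi) (enum 'I_n) (r %/ n))
                          (nth (Ordinal hi) (enum 'I_n) (r %% n)))).
by rewrite !nth_enum_ord.
Qed.

(** * Membership in NP *)

(** It covers the ranks in an arbitrary graph, for completeness of the verifier, and the identity on
    ['I_n], for soundness. *)
Definition numbering (T : Type) (n : nat) (nu : T -> nat) : Prop :=
  [/\ injective nu, forall x, nu x < n & forall i, i < n -> exists x, nu x = i].

Lemma numbering_rank (G : finType) : numbering #|G| (fun x : G => nat_of_ord (enum_rank x)).
Proof.
split=> [x y /ord_inj /enum_rank_inj //|x|i hi]; first exact: ltn_ord.
by exists (enum_val (Ordinal hi)); rewrite enum_valK.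
Qed.

Lemma numbering_ord n : numbering n (@nat_of_ord n).
Proof.
split=> [|i|i hi]; [exact: ord_inj | exact: ltn_ord | by exists (Ordinal hi)].
Qed.

Definition simplicial_bits (n : nat) (b : nat -> nat -> bool) (x : nat) : Prop :=
  forall y, y < n -> forall z, z < n -> b x y -> b x z -> ~ y = z -> b y z.

Definition class_bits (n : nat) (b : nat -> nat -> bool) : Prop :=
  exists2 u, u < n & exists2 v, v < n & ~ u = v /\
    (forall x, x < n -> (simplicial_bits n b x -> x = u \/ x = v) /\
                        (x = u \/ x = v -> simplicial_bits n b x)) /\
    (forall x, x < n -> forall y, y < n ->
       ~ x = u /\ ~ x = v /\ ~ y = u /\ ~ y = v /\ ~ x = y -> b x y).

Lemma class_bitsP (H : sgraph) n (nu : H -> nat) b :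
  numbering n nu -> (forall x y, b (nu x) (nu y) = adj x y) ->
  class_bits n b <-> exists u v : H, clique_and_two u v.
Proof.
move=> [nui nul nus] hb.
have neq x y : (~ nu x = nu y) <-> x != y.
  by split=> [h|/eqP h /nui //]; apply/eqP => e; apply: h; rewrite e.
have simpE x : simplicial_bits n b (nu x) <-> simplicial x.
  split=> [h|/simplicialP h y hy z hz].
    apply/simplicialP => y z hy hz /neq yz.
    by rewrite -hb; apply: h; rewrite ?hb.
  have [[y' <-] [z' <-]] := (nus y hy, nus z hz).
  by rewrite !hb => h1 h2 /neq; apply: h.
split=> [[u hu [v hv [uv [hs hc]]]]|[u [v [uv hs hc]]]].
  have [[u' eu] [v' ev]] := (nus u hu, nus v hv); subst u v.
  exists u', v'; split.
  - exact/neq.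
  - move=> x; have [h1 h2] := hs (nu x) (nul x).
    apply/idP/idP => [/simpE /h1 [/nui ->|/nui ->]|h]; rewrite ?eqxx ?orbT //.
    by apply/simpE/h2; case/orP: h => /eqP ->; [left | right].
  - move=> x y /neq h1 /neq h2 /neq h3 /neq h4 /neq h5.
    by rewrite -hb; apply: hc.
exists (nu u) => //; exists (nu v) => //; split; first exact/neq.
split.
  move=> x hx; have [x' <-] := nus x hx; rewrite simpE hs; split.
    by case/orP=> /eqP ->; [left | right].
  by case=> /nui ->; rewrite eqxx ?orbT.
move=> x hx y hy; have [[x' <-] [y' <-]] := (nus x hx, nus y hy).
by move=> [/neq h1 [/neq h2 [/neq h3 [/neq h4 /neq h5]]]]; rewrite hb; apply: hc.
Qed.

(** [F] is the 0-1 matrix of a map. The clauses say in turn that it is total, single-valued and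
    surjective, that edges of the target lift, and that edges between different fibres descend. *)
Definition map_bits (n m : nat) (a b F : nat -> nat -> bool) : Prop :=
  (forall i, i < n -> exists2 p, p < m & F i p) /\
  (forall i, i < n -> forall p, p < m -> forall q, q < m -> F i p /\ F i q -> p = q) /\
  (forall p, p < m -> exists2 i, i < n & F i p) /\
  (forall p, p < m -> forall q, q < m -> ~ p = q /\ b p q ->
     exists2 i, i < n & exists2 j, j < n & F i p /\ F j q /\ a i j) /\
  (forall i, i < n -> forall j, j < n -> a i j ->
     forall p, p < m -> forall q, q < m -> F i p /\ F j q /\ ~ p = q -> b p q).

Lemma map_bitsP (G H : sgraph) n m (nu : G -> nat) (mu : H -> nat) a b F (f : G -> H) :
  numbering n nu -> numbering m mu ->
  (forall x y, a (nu x) (nu y) = adj x y) ->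
  (forall x y, b (mu x) (mu y) = adj x y) ->
  (forall x y, F (nu x) (mu y) = (f x == y)) ->
  map_bits n m a b F <-> quotient_map f.
Proof.
move=> [nui nul nus] [mui mul mus] ha hb hF; split=> [[_ [_ [h3 [h4 h5]]]]|[sf hf]].
  split=> [p|p q pq].
    have [i hi] := h3 (mu p) (mul p); have [x <-] := nus i hi.
    by rewrite hF => /eqP; exists x.
  split=> [h|[x [y [ex ey h]]]].
    have [|i hi [j hj]] := h4 (mu p) (mul p) (mu q) (mul q).
      by rewrite hb; split=> // /mui e; rewrite e eqxx in pq.
    have [[x <-] [y <-]] := (nus i hi, nus j hj).
    by rewrite !hF ha => -[/eqP e1 [/eqP e2 e3]]; exists x, y.
  rewrite -hb; apply: (h5 (nu x) (nul x) (nu y) (nul y)); rewrite ?ha ?hF ?ex ?ey //.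
  by rewrite !eqxx; split=> //; split=> // /mui e; rewrite e eqxx in pq.
split; [|split; [|split; [|split]]].
- by move=> i hi; have [x <-] := nus i hi; exists (mu (f x)); rewrite ?hF.
- move=> i hi p hp q hq; have [x <-] := nus i hi.
  have [[p' <-] [q' <-]] := (mus p hp, mus q hq).
  by rewrite !hF => -[/eqP -> /eqP ->].
- move=> p hp; have [p' <-] := mus p hp; have [x <-] := sf p'.
  by exists (nu x); rewrite ?hF.
- move=> p hp q hq; have [[p' <-] [q' <-]] := (mus p hp, mus q hq).
  rewrite hb => -[pq /hf] [|x [y [ex ey h]]]; first by apply/eqP => e; rewrite e in pq.
  by exists (nu x) => //; exists (nu y) => //; rewrite !hF ha ex ey.
- move=> i hi j hj; have [[x <-] [y <-]] := (nus i hi, nus j hj); rewrite ha => h p hp q hq.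
  have [[p' <-] [q' <-]] := (mus p hp, mus q hq).
  rewrite !hF hb => -[/eqP e1 [/eqP e2 ne]]; apply/hf; last by exists x, y.
  by apply/eqP => e; apply: ne; rewrite e.
Qed.

Definition twice (e : expr) : expr := Mul (Cst 2) e.
Definition twice1 (e : expr) : expr := Add (Mul (Cst 2) e) (Cst 1).
Definition code_len (n : expr) : expr := Add (Add n (Cst 1)) (Mul n n).
Definition entry_e (n i j : expr) : expr := Add (Add n (Cst 1)) (Add (Mul i n) j).

Section Verifier.

Let k := Var 0.
Let n := Var 1.
Let m := Var 2.

(* Positions in [pair_word (pair_word g h) y] of a bit of [g], [h] and [y],
   where [k] is the length of [pair_word g h] and [g], [h] are codes of graphs
   with [n] and [m] vertices. *)
Definition gbit (e : expr) : form := FBit (twice1 (twice1 e)).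
Definition hbit (e : expr) : form :=
  FBit (twice1 (Add (twice1 (code_len n)) e)).
Definition ybit (e : expr) : form := FBit (Add (twice1 k) e).

Definition graph_form (n : expr) (b : expr -> form) : form :=
  FAnd (FAll n (b (Var 3))) (FAnd (FNot (b n))
    (FAnd (FAll n (FNot (b (entry_e n (Var 3) (Var 3)))))
      (FAll n (FAll n (FImp (b (entry_e n (Var 3) (Var 4)))
                            (b (entry_e n (Var 4) (Var 3)))))))).

Let a i j := gbit (entry_e n i j).
Let b i j := hbit (entry_e m i j).
Let F i p := ybit (Add (Mul i m) p).

(** It is used under the binders of [u], [v] and [x], which are levels 3 to 5, so its own variables
    are 6 and 7. *)
Definition simplicial_form (x : expr) : form :=
  FAll m (FAll m (FImp (b x (Var 6)) (FImp (b x (Var 7))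
    (FImp (FNot (FEq (Var 6) (Var 7))) (b (Var 6) (Var 7)))))).

Definition class_form : form :=
  let: u := Var 3 in let: v := Var 4 in let: x := Var 5 in let: y := Var 6 in
  FEx m (FEx m (FAnd (FNot (FEq u v))
    (FAnd
      (FAll m (FAnd (FImp (simplicial_form x) (FOr (FEq x u) (FEq x v)))
                    (FImp (FOr (FEq x u) (FEq x v)) (simplicial_form x))))
      (FAll m (FAll m (FImp
         (FAnd (FNot (FEq x u)) (FAnd (FNot (FEq x v)) (FAnd (FNot (FEq y u))
           (FAnd (FNot (FEq y v)) (FNot (FEq x y))))))
         (b x y))))))).

Definition map_form : form :=
  FAnd (FAll n (FEx m (F (Var 3) (Var 4))))
  (FAnd (FAll n (FAll m (FAll m (FImp (FAnd (F (Var 3) (Var 4)) (F (Var 3) (Var 5)))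
                                      (FEq (Var 4) (Var 5))))))
  (FAnd (FAll m (FEx n (F (Var 4) (Var 3))))
  (FAnd (FAll m (FAll m (FImp (FAnd (FNot (FEq (Var 3) (Var 4))) (b (Var 3) (Var 4)))
           (FEx n (FEx n (FAnd (F (Var 5) (Var 3)) (FAnd (F (Var 6) (Var 4))
                                                         (a (Var 5) (Var 6)))))))))
        (FAll n (FAll n (FImp (a (Var 3) (Var 4))
           (FAll m (FAll m (FImp (FAnd (F (Var 3) (Var 5)) (FAnd (F (Var 4) (Var 6))
                                   (FNot (FEq (Var 5) (Var 6)))))
              (b (Var 5) (Var 6)))))))))) ).

(** The outer quantifiers recover [k], [n] and [m] at levels 0 to 2; the separators in the codes
    force their values. *)
Definition verifier_form : form :=
  FEx Size (FEx Size (FEx Size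
    (FAnd (FEq k (Add (twice1 (code_len n)) (code_len m)))
    (FAnd (FAnd (FAll k (FBit (twice (Var 3)))) (FNot (FBit (twice k))))
    (FAnd (FAnd (FAll (code_len n) (FBit (twice1 (twice (Var 3)))))
                (FNot (FBit (twice1 (twice (code_len n))))))
    (FAnd (graph_form n gbit)
    (FAnd (graph_form m hbit)
    (FAnd map_form class_form)))))))).

End Verifier.

Lemma verifierP (u : word) : sem u [::] verifier_form <->
  exists2 k, k < size u & exists2 n, n < size u & exists2 m, m < size u &
  let N := n + 1 + n * n in let M := m + 1 + m * m in
  let g e := nth false u (2 * (2 * e + 1) + 1) in
  let h e := nth false u (2 * (2 * N + 1 + e) + 1) in
  let y e := nth false u (2 * k + 1 + e) in
  k = 2 * N + 1 + M /\
  ((forall i, i < k -> nth false u (2 * i)) /\ ~ nth false u (2 * k)) /\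
  ((forall i, i < N -> nth false u (2 * (2 * i) + 1)) /\
    ~ nth false u (2 * (2 * N) + 1)) /\
  graph_bits n g /\ graph_bits m h /\
  map_bits n m (fun i j => g (entry n i j)) (fun i j => h (entry m i j))
    (fun i p => y (i * m + p)) /\
  class_bits m (fun i j => h (entry m i j)).
Proof.
split.
  move=> [k hk [n hn [m hm [h1 [h2 [h3 [[g1 [g2 [g3 g4]]] [[i1 [i2 [i3 i4]]] [h6 h7]]]]]]]]].
  exists k; first exact hk. exists n; first exact hn. exists m; first exact hm.
  cbv zeta.
  split; first exact h1. split; first exact h2. split; first exact h3.
  split; first by split. split; first by split.
  by split; [exact h6 | exact h7].
move=> [k hk [n hn [m hm [h1 [h2 [h3 [[g1 g2 g3 g4] [[i1 i2 i3 i4] [h6 h7]]]]]]]]].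
exists k; first exact hk. exists n; first exact hn. exists m; first exact hm.
  cbv zeta.
split; first exact h1. split; first exact h2. split; first exact h3.
split; first by do 3 split=> //. split; first by do 3 split=> //.
by split; [exact h6 | exact h7].
Qed.

Lemma entry_lt n i j : i < n -> j < n -> entry n i j < n + 1 + n * n.
Proof.
move=> hi hj; rewrite /entry ltn_add2l.
by apply: (@leq_trans (i.+1 * n)); [rewrite mulSn; lia | rewrite leq_mul2r hi orbT].
Qed.

Lemma eq_graph_bits n b b' : (forall e, e < n + 1 + n * n -> b e = b' e) ->
  graph_bits n b -> graph_bits n b'.
Proof.
move=> e [h1 h2 h3 h4]; split.
- by move=> i hi; rewrite -e ?h1 //; lia.
- by rewrite -e //; lia.
- by move=> i hi; rewrite -e ?entry_lt //; apply: h3.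
- by move=> i hi j hj; rewrite -!e ?entry_lt //; apply: h4.
Qed.

Lemma eq_mkseq_in (f g : nat -> bool) n : (forall i, i < n -> f i = g i) ->
  mkseq f n = mkseq g n.
Proof. by move=> h; apply/eq_in_map => i; rewrite mem_iota => /h. Qed.

Definition identification_class (GH : sgraph * sgraph) : Prop :=
  let H := GH.2 in
  [/\ split_graph H, interval_graph H & #|[set v : H | simplicial v]| = 2].

Lemma identification_complete (G H : sgraph) :
  identification_class (G, H) -> identifies_to G H ->
  let x := pair_word (graph_code G) (graph_code H) in
  exists y : word, size y <= (size x) ^ 2 /\ sem (pair_word x y) [::] verifier_form.
Proof.
move=> /split_interval_two_simplicialP hcl /identifies_toP [f qf] x.
set n := #|G|; set m := #|H|; set N := n + 1 + n * n; set M := m + 1 + m * m.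
(* The certificate is the matrix of the quotient map, row by row. *)
exists [seq f v == p | v <- enum G, p <- enum H]; set y := (X in size X).
have sx : size x = 2 * N + 1 + M by rewrite size_pair_word !size_graph_code.
have sy : size y = n * m by rewrite size_allpairs -!cardE.
split.
  rewrite sy expnS expn1; apply: leq_mul; rewrite sx /N /M; lia.
set u := pair_word x y.
have su : size u = 2 * size x + 1 + size y by rewrite size_pair_word.
apply/verifierP; exists (size x); first by rewrite su; lia.
exists n; first by rewrite su sx /N; lia.
exists m; first by rewrite su sx /M; lia.
rewrite -/N -/M; set g := fun e => nth false u (2 * (2 * e + 1) + 1).
set h := fun e => nth false u (2 * (2 * N + 1 + e) + 1).
have hg e : e < N -> nth false (graph_code G) e = g e.
  move=> he; rewrite /g nth_pair_odd ?sx; last lia.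
  by rewrite nth_pair_odd ?size_graph_code.
have hh e : e < M -> nth false (graph_code H) e = h e.
  move=> he; rewrite /h nth_pair_odd ?sx; last lia.
  by rewrite /N -size_graph_code nth_pair_right.
have ag (v w : G) : g (entry n (enum_rank v) (enum_rank w)) = adj v w.
  by rewrite -hg; [exact: nth_graph_code_rank | apply: entry_lt; apply: ltn_ord].
have ah (v w : H) : h (entry m (enum_rank v) (enum_rank w)) = adj v w.
  by rewrite -hh; [exact: nth_graph_code_rank | apply: entry_lt; apply: ltn_ord].
cbv zeta; split=> //; split.
  by split=> [i hi|]; [rewrite nth_pair_even | rewrite nth_pair_sep].
split.
  split=> [i hi|].
    rewrite nth_pair_odd ?sx; last lia.
    by rewrite nth_pair_even // size_graph_code.
  rewrite nth_pair_odd ?sx; last lia.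
  by rewrite /N -size_graph_code nth_pair_sep.
split; first exact: eq_graph_bits hg (graph_bits_code G).
split; first exact: eq_graph_bits hh (graph_bits_code H).
split; last by apply/(class_bitsP (numbering_rank H) ah).
apply/(map_bitsP (f := f) (numbering_rank G) (numbering_rank H) ag ah) => // v p.
have em : m = size (enum H) by rewrite -cardE.
by rewrite nth_pair_right /y em (nth_allpairs _ v p) -?cardE ?ltn_ord // !nth_enum_rank.
Qed.

Lemma identification_sound (x y : word) :
  sem (pair_word x y) [::] verifier_form ->
  exists G H : sgraph, [/\ x = pair_word (graph_code G) (graph_code H),
    identification_class (G, H) & identifies_to G H].
Proof.
set u := pair_word x y.
move/verifierP => [k _ [n _ [m _]]] /=.
set N := n + 1 + n * n; set M := m + 1 + m * m.
set g := fun e => nth false u (2 * (2 * e + 1) + 1).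
set h := fun e => nth false u (2 * (2 * N + 1 + e) + 1).
set F := fun i p => nth false u (2 * k + 1 + (i * m + p)).
move=> [ek [[k1 k2] [[p1 p2] [hg [hh [hmap hcl]]]]]].
(* Both numbers are the index of the first unmarked even position. *)
have sx : size x = k.
  have [lt|gt|//] := ltngtP (size x) k.
    by have := k1 _ lt; rewrite nth_pair_sep.
  by case: k2; rewrite nth_pair_even.
have [sg [ig eG]] := graph_of_bits hg; have [sh [ih eH]] := graph_of_bits hh.
set G := SGraph _ _ in eG; set H := SGraph _ _ in eH.
exists G, H; split.
- rewrite eG eH -/N -/M.
  have -> : mkseq g N = mkseq (fun i => nth false x (2 * i + 1)) N.
    by apply: eq_mkseq_in => i hi; rewrite /g nth_pair_odd // sx; lia.
  have -> : mkseq h M = mkseq (fun i => nth false x (2 * N + 1 + i)) (size x - (2 * N + 1)).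
    have -> : size x - (2 * N + 1) = M by lia.
    by apply: eq_mkseq_in => i hi; rewrite /h nth_pair_odd // sx; lia.
  apply: pair_wordE; first by rewrite sx; lia.
    by move=> i hi; rewrite -(@nth_pair_odd x y) ?sx; [apply: p1 | lia].
  by rewrite -(@nth_pair_odd x y) ?sx //; lia.
- apply/split_interval_two_simplicialP.
  exact: (@class_bitsP H m (@nat_of_ord m) _ (numbering_ord m) (fun _ _ => erefl)).1 hcl.
- apply/identifies_toP.
  have [f1 [f2 _]] := hmap.
  have ex (i : 'I_n) : exists p : 'I_m, F i p.
    by have [p hp hF] := f1 i (ltn_ord i); exists (Ordinal hp).
  pose f (i : G) : H := xchoose (ex i).
  have hF (i : G) (p : H) : F i p = (f i == p).
    have hf := xchooseP (ex i).
    apply/idP/eqP => [hip|<- //]; apply: ord_inj.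
    exact: (f2 i (ltn_ord i) _ (ltn_ord _) _ (ltn_ord _)).
  exists f.
  exact: (@map_bitsP G H n m (@nat_of_ord n) (@nat_of_ord m) _ _ F f (numbering_ord n)
    (numbering_ord m) (fun _ _ => erefl) (fun _ _ => erefl) hF).1 hmap.
Qed.

Lemma weval_form w p : weval w [::] (WBit (expr_of p)) = [:: true] <-> sem w [::] p.
Proof. by rewrite sem_iff; split=> [[]|h] //; congr [:: _]. Qed.

Lemma in_NP_form (L : word -> Prop) (p : {poly nat}) (phi : form) :
  (forall x, L x <-> exists y : word, size y <= p.[size x]%R /\
                       sem (pair_word x y) [::] phi) -> in_NP L.
Proof.
move=> h; exists (fun u => weval u [::] (WBit (expr_of phi))), p.
split=> [|x]; first exact: polytime_weval.
by rewrite h; split=> -[y [sy hy]]; exists y; split=> //; apply/weval_form.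
Qed.

Theorem identification_in_NP :
  in_NP (language (@restrict Identification identification_class)).
Proof.
apply: (@in_NP_form _ ('X^2)%R verifier_form) => x.
have p2 k : ('X^2).[k]%R = k ^ 2 by rewrite hornerXn.
split=> [[[[G H] hcl] -> hyes]|[y [_ /identification_sound]]].
  have [y [sy hy]] := identification_complete hcl hyes.
  by exists y; rewrite p2.
by move=> [G [H [-> hcl hid]]]; exists (exist _ (G, H) hcl).
Qed.

(** * Tableaux of Turing machine computations *)

Section Tableau.

Variable M : TM.

Let K := (tm_ntapes_pred M).+1.
Let tcell := cell (tm_aux M).

(* Column [j] of a configuration: the state and, for every tape, the cells at
   distance [j] from the head, first on the right (the head itself being at
   distance 0), then on the left (the left neighbour being at distance 0). *)
Definition column : finType := (tm_state M * (K.-tuple tcell * K.-tuple tcell))%type.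

Definition rcells (T : tape (tm_aux M)) : seq tcell := tcur T :: tright T.

Definition column_at (c : config M) (j : nat) : column :=
  (cstate c, ([tuple nth None (rcells (tnth (ctapes c) i)) j | i < K],
              [tuple nth None (tleft (tnth (ctapes c) i)) j | i < K])).

(** The columns [a], [b], [c] stand at distances [j.-1], [j], [j + 1], and [d] is column 0, which
    shows the state and the scanned symbols. The flags mark [j = 0] and [j = 1]. After a left move
    the written symbol is at distance 1 on the right, where [a] still shows the old one. *)
Definition next_column (z0 z1 : bool) (a b c d : column) : column :=
  if tm_halt d.1 then b else
  let: (q, acts) := tm_trans d.1 d.2.1 in
  (q, ([tuple (let: (w, m) := tnth acts i in
               match m with
               | MoveL => if z0 then tnth d.2.2 i else if z1 then w else tnth a.2.1 i
               | MoveR => tnth c.2.1 i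
               | Stay => if z0 then w else tnth b.2.1 i
               end) | i < K],
       [tuple (let: (w, m) := tnth acts i in
               match m with
               | MoveL => tnth c.2.2 i
               | MoveR => if z0 then w else tnth a.2.2 i
               | Stay => tnth b.2.2 i
               end) | i < K])).

Lemma column_at_step (c : config M) j :
  column_at (tm_step c) j =
  next_column (j == 0) (j == 1) (column_at c j.-1) (column_at c j)
    (column_at c j.+1) (column_at c 0).
Proof.
rewrite /next_column /= /tm_step; case: ifP => // _.
have -> : [tuple nth None (rcells (tnth (ctapes c) i)) 0 | i < K] =
          [tuple of map (@tcur _) (ctapes c)].
  by apply: eq_from_tnth => i; rewrite tnth_mktuple tnth_map.
case: (tm_trans _ _) => q acts; congr (_, (_, _)); apply: eq_from_tnth => i;
  rewrite !tnth_mktuple /= ?tnth_mktuple; case: (tnth acts i) => w m;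
  by case: m => /=; case: (tnth (ctapes c) i) => [[|l L] h [|r R]];
     case: j => [|[|j]] //=; rewrite ?nth_nil.
Qed.

Definition start_column (c : tcell) : column :=
  (tm_start M, ([tuple (if i == ord0 then c else None) | i < K], [tuple None | i < K])).

Lemma start_column_inj : injective start_column.
Proof.
move=> c c' /(congr1 (fun s : column => tnth s.2.1 ord0)).
by rewrite /= !tnth_mktuple eqxx.
Qed.

Definition wcell (u : word) (j : nat) : tcell := nth None [seq Some (inl b) | b <- u] j.

Lemma column_at_init u j : column_at (tm_init M u) j = start_column (wcell u j).
Proof.
congr (_, (_, _)); apply: eq_from_tnth => i; rewrite !tnth_mktuple.
  case: eqP => _; last by case: j => [|j] //=; rewrite nth_nil.
  rewrite /rcells /input_tape /wcell; case: u => [|b u] //=.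
  by case: j => // j /=; rewrite nth_nil.
by case: eqP => _; rewrite nth_nil.
Qed.

Definition is_bit (c : tcell) : bool := if c is Some (inl _) then true else false.

Definition out_cell (s : column) : tcell := tnth s.2.1 ord0.

Lemma out_cell_at c j :
  out_cell (column_at c j) = nth None (rcells (tnth (ctapes c) ord0)) j.
Proof. by rewrite /out_cell tnth_mktuple. Qed.

(** The output ends before the first cell that is not a bit, so two columns decide acceptance. *)
Lemma tm_output_trueP (c : config M) : tm_output c = [:: true] <->
  out_cell (column_at c 0) = Some (inl true) /\ ~~ is_bit (out_cell (column_at c 1)).
Proof.
rewrite !out_cell_at /tm_output -/(rcells _).
by case: (rcells _) => [|[[[]|g]|] [|[[b'|g']|] l]] //=; split=> //; case.
Qed.

(* The clauses excluding that the machine halts with an output other than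
   [:: true] or does not halt by the last row. *)
Definition rejecting (N t j : nat) (s : column) : Prop :=
  (j = 0 /\ tm_halt s.1 && (out_cell s != Some (inl true))) \/
  (j = 1 /\ tm_halt s.1 && is_bit (out_cell s)) \/
  (t + 1 = N /\ j = 0 /\ ~~ tm_halt s.1).

(** These are the places of [true] in the part of the pair word determined by [x]; the separator at
    [2 * size x] is not among them. *)
Definition prefix_bit (x : word) (j : nat) : Prop :=
  exists2 i, i < size x & j = 2 * i \/ (j = 2 * i + 1 /\ nth false x i).

Definition guessed (x : word) (P j : nat) : Prop :=
  2 * size x + 1 <= j /\ j + 1 <= 2 * size x + 1 + P.

Definition allowed (x : word) (P j : nat) (s : column) : Prop :=
  (s == start_column (Some (inl true)) /\
     ((j <= 2 * size x /\ prefix_bit x j) \/ guessed x P j)) \/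
  (s == start_column (Some (inl false)) /\
     ((j <= 2 * size x /\ ~ prefix_bit x j) \/ guessed x P j)) \/
  (s == start_column None /\ 2 * size x + 1 <= j).

(** Several columns may be asserted at one place; it is enough that those of the actual run are
    forced to be among them. The third condition makes blanks persist to the right, so that row 0
    contains a certificate followed by blanks. *)
Definition tableau (x : word) (P N : nat) (v : nat -> nat -> column -> bool) : Prop :=
  [/\ forall t j, t + 1 < N -> j + 1 < N -> forall a b c d,
        v t j.-1 a -> v t j b -> v t (j + 1) c -> v t 0 d ->
        v (t + 1) j (next_column (j == 0) (j == 1) a b c d),
      forall j, j < N -> exists2 s, allowed x P j s & v 0 j s,
      forall j, 2 * size x + 1 <= j -> j + 1 < N ->
        v 0 j (start_column None) -> v 0 (j + 1) (start_column None) &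
      forall t j s, t < N -> j < N -> rejecting N t j s -> ~ v t j s].

Lemma prefix_bitP x y j : j <= 2 * size x ->
  prefix_bit x j <-> nth false (pair_word x y) j.
Proof.
move=> hj; split=> [[i hi [->|[-> h]]]|h].
- exact: nth_pair_even.
- by rewrite nth_pair_odd.
have := odd_double_half j; rewrite -mul2n.
case: (odd j) (j./2) => i /= e; subst j.
  have hi : i < size x by lia.
  by exists i => //; right; rewrite addnC; split=> //; move: h; rewrite addnC nth_pair_odd.
exists i; last by left.
rewrite ltn_neqAle andbC; apply/andP; split; first lia.
by apply/eqP => ei; rewrite ei nth_pair_sep in h.
Qed.

Lemma wcell_lt u j : j < size u -> wcell u j = Some (inl (nth false u j)).
Proof. by move=> h; rewrite /wcell (nth_map false). Qed.

Lemma wcell_ge u j : size u <= j -> wcell u j = None.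
Proof. by move=> h; rewrite /wcell nth_default // size_map. Qed.

Lemma allowed_pair x y P j : size y <= P ->
  allowed x P j (start_column (wcell (pair_word x y) j)).
Proof.
move=> sy; have [hj|hj] := ltnP j (size (pair_word x y)); last first.
  rewrite wcell_ge //; right; right; split=> //.
  by move: hj; rewrite size_pair_word; lia.
rewrite wcell_lt //; rewrite size_pair_word in hj.
have hg : 2 * size x < j -> guessed x P j by rewrite /guessed; lia.
case e: (nth _ _ _); [left | right; left]; split=> //.
  by have [le|/hg] := leqP j (2 * size x); [left; split=> //; apply/(prefix_bitP y) | right].
have [le|/hg] := leqP j (2 * size x); last by right.
by left; split=> //; move/(prefix_bitP y le); rewrite e.
Qed.

(* The guess [y] is read off row 0: it stops where a blank is asserted. *)
Lemma tableau_guess x P N v : 2 * size x + 1 + P < N -> tableau x P N v ->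
  exists2 y, size y <= P &
    forall j, j < N -> v 0 j (start_column (wcell (pair_word x y) j)).
Proof.
move=> hN [_ h2 h3 _]; set o := 2 * size x + 1.
pose blank i := v 0 (o + i) (start_column None).
have [m hm [hlt hbl]] : exists2 m, m <= P & (forall i, i < m -> ~~ blank i) /\ blank m.
  have ex : exists i, (i <= P) && blank i.
    exists P; rewrite leqnn /=.
    have [s al hv] := h2 (o + P) ltac:(lia).
    case: al hv => [[_ []]|[[_ []]|[/eqP -> _]]] //; rewrite /guessed; lia.
  exists (ex_minn ex); case: ex_minnP => m /andP[mP bm] mmin //.
  by split=> // i hi; apply/negP => bi; have := mmin i; rewrite bi andbT; lia.
pose y := mkseq (fun i => v 0 (o + i) (start_column (Some (inl true)))) m.
have sy : size y = m by rewrite size_mkseq.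
exists y; first by rewrite sy.
move=> j hj.
have [hjo|hjo] := ltnP j o.
  have le : j <= 2 * size x by rewrite /o in hjo; lia.
  rewrite wcell_lt ?size_pair_word; last lia.
  have [s al hv] := h2 j hj.
  case: al hv => [[/eqP -> hb]|[[/eqP -> hb]|[_ hb]]] hv; last by exfalso; lia.
  - case: hb => [[_ /(prefix_bitP y le) ->]|] //; rewrite /guessed; lia.
  - case: hb => [[_ hn]|]; last by rewrite /guessed; lia.
    suff -> : nth false (pair_word x y) j = false by [].
    by apply/negP => /(prefix_bitP y le).
have ej : j = o + (j - o) by lia.
have [hjm|hjm] := ltnP (j - o) m.
  rewrite wcell_lt ?size_pair_word; last by rewrite sy /o in hjm *; lia.
  have -> : nth false (pair_word x y) j = v 0 j (start_column (Some (inl true))).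
    by rewrite {1}ej nth_pair_right nth_mkseq // -ej.
  case e: (v 0 j (start_column (Some (inl true)))); first exact: e.
  have [s al hv] := h2 j hj.
  case: al hv => [[/eqP -> _]|[[/eqP -> _]|[/eqP -> _]]]; rewrite ?e // => hb.
  by have := hlt _ hjm; rewrite /blank -ej hb.
rewrite wcell_ge ?size_pair_word; last by rewrite sy; lia.
have hb i : o + m + i < N -> v 0 (o + m + i) (start_column None).
  elim: i => [|i IH] hi; first by rewrite addn0.
  rewrite addnS -addn1; apply: h3; [by rewrite -/o; lia | lia | apply: IH; lia].
have -> : j = o + m + (j - o - m) by lia.
by apply: hb; lia.
Qed.

(** Column [j] depends on column [j + 1] one step earlier, so the controlled part of a row shrinks
    by one column per step. *)
Lemma tableau_run x P N v y : 2 * size x + 1 + P < N -> tableau x P N v ->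
  (forall j, j < N -> v 0 j (start_column (wcell (pair_word x y) j))) ->
  forall t j, t + j < N ->
    v t j (column_at (iter t (@tm_step M) (tm_init M (pair_word x y))) j).
Proof.
move=> hN [h1 _ _ _] h0; elim=> [|t IH] j hj; first by rewrite column_at_init; apply: h0.
rewrite iterS column_at_step -addn1; apply: h1; try lia; try (apply: IH; lia).
by rewrite addn1; apply: IH; lia.
Qed.

Lemma iter_halt_eq (c : config M) s t :
  tm_halt (cstate (iter s (@tm_step M) c)) -> tm_halt (cstate (iter t (@tm_step M) c)) ->
  iter s (@tm_step M) c = iter t (@tm_step M) c.
Proof.
wlog le : s t / s <= t => [hw|].
  by have [/hw|/ltnW /hw h hs ht] := leqP s t; last by rewrite h.
by move=> hs _; rewrite -(subnK le) iterD (iter_halted (t - s) hs).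
Qed.

Lemma tableauP x P N (V : word -> word) (q : {poly nat}) :
  (forall u, tm_computes_within M u q.[size u]%R (V u)) ->
  (forall y, size y <= P -> q.[size (pair_word x y)]%R + 2 <= N) ->
  2 * size x + 1 + P < N ->
  (exists v, tableau x P N v) <->
  (exists y : word, size y <= P /\ V (pair_word x y) = [:: true]).
Proof.
move=> hV hq hN; split=> [[v hv]|[y [sy hy]]].
  have [y sy h0] := tableau_guess hN hv.
  exists y; split=> //; have hr := tableau_run hN hv h0.
  set u := pair_word x y in hr *; have [_ _ _ h4] := hv.
  set run := fun t => iter t (@tm_step M) (tm_init M u).
  have qN := hq y sy; set tau := (q.[_])%R in qN.
  have [hh ho] : tm_halt (cstate (run tau)) /\ tm_output (run tau) = V u := hV u.
  have late t : tau <= t -> run t = run tau.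
    by move=> le; rewrite /run -(subnK le) iterD iter_halted.
  rewrite -ho; apply/tm_output_trueP.
  (* Row [N - 2] is late enough for the machine to have halted and early enough for columns 0 and 1
     to be controlled. *)
  have e : run (N - 2) = run tau by apply: late; lia.
  have hN2 : N - 2 < N by lia.
  rewrite -e in hh *; split.
    apply/eqP; apply: contraT => h; case: (h4 (N - 2) 0 (column_at (run (N - 2)) 0)) => //.
    - lia.
    - by left; rewrite hh.
    - by apply: hr; lia.
  apply/negP => h; case: (h4 (N - 2) 1 (column_at (run (N - 2)) 1)) => //.
  - lia.
  - by right; left; rewrite hh.
  - by apply: hr; lia.
set u := pair_word x y in hy *.
set run := fun t => iter t (@tm_step M) (tm_init M u).
have qN := hq y sy; set tau := (q.[_])%R in qN.
have [hh ho] : tm_halt (cstate (run tau)) /\ tm_output (run tau) = V u := hV u.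
have [o0 o1] := (tm_output_trueP _).1 (etrans ho hy).
exists (fun t j s => s == column_at (run t) j); split.
- move=> t j _ _ a b c d /eqP -> /eqP -> /eqP -> /eqP ->.
  by rewrite !addn1 /run iterS column_at_step.
- move=> j _; exists (column_at (run 0) j) => //.
  by rewrite column_at_init; apply: allowed_pair.
- move=> j _ _; rewrite /run /= !column_at_init !(inj_eq start_column_inj) => /eqP.
  have [h|h _] := ltnP j (size u); first by rewrite wcell_lt.
  by rewrite wcell_ge //; lia.
- move=> t j s ht hj hrej /eqP es; subst s; case: hrej => [[ej]|[[ej]|[et [ej]]]]; subst j.
  + by case/andP=> h; rewrite /run (iter_halt_eq h hh) -/(run tau) o0 eqxx.
  + by case/andP=> h; rewrite /run (iter_halt_eq h hh) -/(run tau) (negbTE o1).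
  (* Here [t] is the last row [N - 1], by which the machine has halted. *)
  + have le : tau <= t by lia.
    by rewrite /= /run -(subnK le) iterD iter_halted ?hh.
Qed.

End Tableau.

(** * Tableaux as hypergraph colourings *)

Definition horner_expr (s : seq nat) (e : expr) : expr :=
  foldr (fun a r => Add (Mul r e) (Cst a)) (Cst 0) s.

Lemma eval_horner_expr w env (p : {poly nat}) e :
  eval w env (horner_expr p e) = p.[eval w env e]%R.
Proof. by rewrite /horner; elim: (polyseq p) => //= a s ->. Qed.

Lemma horner_nat_mono (p : {poly nat}) (a b : nat) : a <= b -> p.[a]%R <= p.[b]%R.
Proof.
move=> h; rewrite /horner; elim: (polyseq p) => //= c s IH.
by apply: leq_add => //; apply: leq_mul.
Qed.

Section Reduction.

Variables (M : TM) (p q : {poly nat}).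

Let col := column M.

(** One shape per condition of [tableau]: [inl] for transitions, [inr (inl true)] for the allowed
    columns of row 0, [inr (inl false)] for persistence of blanks, and [inr (inr s)] for the
    exclusion of a rejecting [s]. *)
Definition clause : finType := (col * col * (col * col) + (bool + col))%type.
(** [inl o] is the two-point hyperedge that gives a literal and its negation different colours;
    [inr c] is the hyperedge of a clause. *)
Definition kind : finType := (option col + clause)%type.
Definition lab : finType := (option col * bool)%type.

Definition guard (x : word) (N : nat) (c : clause) (t j : nat) : Prop :=
  match c with
  | inl _ => t + 1 + 1 <= N /\ j + 1 + 1 <= N
  | inr (inl true) => t = 0
  | inr (inl false) => t = 0 /\ 2 * size x + 1 <= j /\ j + 1 + 1 <= N
  | inr (inr s) => rejecting N t j s
  end.

(* The literal [(s, b)] at [(t', j')] belongs to the clause [c] at [(t, j)];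
   [b = false] marks a negated variable. *)
Definition literal (x : word) (P : nat) (c : clause) (s : col) (b : bool)
    (t j t' j' : nat) : Prop :=
  match c with
  | inl (c1, c2, (c3, c4)) =>
      if b then t' = t + 1 /\ j' = j /\
        ((j = 0 /\ s == next_column true false c1 c2 c3 c4) \/
         (j = 1 /\ s == next_column false true c1 c2 c3 c4) \/
         (2 <= j /\ s == next_column false false c1 c2 c3 c4))
      else t' = t /\
        ((s == c1 /\ ((j = 0 /\ j' = 0) \/ j' + 1 = j)) \/
         (s == c2 /\ j' = j) \/ (s == c3 /\ j' = j + 1) \/ (s == c4 /\ j' = 0))
  | inr (inl true) => b /\ t' = t /\ j' = j /\ allowed x P j s
  | inr (inl false) =>
      s == @start_column M None /\ t' = t /\ (if b then j' = j + 1 else j' = j)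
  | inr (inr s0) => ~~ b /\ s == s0 /\ t' = t /\ j' = j
  end.

(* The vertex [(None, true)] at [(0, 0)] stands for "false" and lies in every
   clause; a clause outside its guard contains all vertices. *)
Definition hyper (x : word) (P N : nat) (k : kind) (l : lab) (t j t' j' : nat) : Prop :=
  match k with
  | inl o => o == l.1 /\ t' = t /\ j' = j
  | inr c => ~ guard x N c t j \/ (l == (None, true) /\ t' = 0 /\ j' = 0) \/
      match l.1 with
      | Some s => literal x P c s l.2 t j t' j'
      | None => false
      end
  end.

Definition guess_expr : expr := horner_expr p Size.
Definition input_expr : expr := Add (twice1 Size) guess_expr.
(** It exceeds the running time by at least 2 and the length of the longest input by at least 1, as
    [tableauP] demands. *)
Definition dim_expr : expr := Add (Add (horner_expr q input_expr) input_expr) (Cst 3).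

Definition guess_len (x : word) : nat := p.[size x]%R.
Definition dim (x : word) : nat :=
  q.[2 * size x + 1 + guess_len x]%R + (2 * size x + 1 + guess_len x) + 3.

Lemma eval_guess x env : eval x env guess_expr = guess_len x.
Proof. by rewrite eval_horner_expr. Qed.

Lemma eval_dim x env : eval x env dim_expr = dim x.
Proof.
have e : eval x env input_expr = 2 * size x + 1 + guess_len x by rewrite -(eval_guess x env).
rewrite -[LHS]/(eval x env (horner_expr q input_expr) + eval x env input_expr + 3).
by rewrite eval_horner_expr e.
Qed.

Definition succ_e (e : expr) : expr := Add e (Cst 1).

Definition rejecting_form (t j : expr) (s : col) : form :=
  FOr (FAnd (FEq j (Cst 0)) (FBool (tm_halt s.1 && (out_cell s != Some (inl true)))))
  (FOr (FAnd (FEq j (Cst 1)) (FBool (tm_halt s.1 && is_bit (out_cell s))))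
       (FAnd (FEq (succ_e t) dim_expr) (FAnd (FEq j (Cst 0)) (FBool (~~ tm_halt s.1))))).

Definition guard_form (c : clause) (t j : expr) : form :=
  match c with
  | inl _ => FAnd (FLe (succ_e (succ_e t)) dim_expr) (FLe (succ_e (succ_e j)) dim_expr)
  | inr (inl true) => FEq t (Cst 0)
  | inr (inl false) => FAnd (FEq t (Cst 0))
      (FAnd (FLe (twice1 Size) j) (FLe (succ_e (succ_e j)) dim_expr))
  | inr (inr s) => rejecting_form t j s
  end.

(** The environment consists of the four coordinates of a pair of vertices, so the bound position
    has level 4. *)
Definition prefix_form (j : expr) : form :=
  FEx Size (FOr (FEq j (twice (Var 4))) (FAnd (FEq j (twice1 (Var 4))) (FBit (Var 4)))).

Definition guessed_form (j : expr) : form :=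
  FAnd (FLe (twice1 Size) j) (FLe (succ_e j) input_expr).

Definition allowed_form (j : expr) (s : col) : form :=
  FOr (FAnd (FBool (s == @start_column M (Some (inl true))))
        (FOr (FAnd (FLe j (twice Size)) (prefix_form j)) (guessed_form j)))
  (FOr (FAnd (FBool (s == @start_column M (Some (inl false))))
        (FOr (FAnd (FLe j (twice Size)) (FNot (prefix_form j))) (guessed_form j)))
       (FAnd (FBool (s == @start_column M None)) (FLe (twice1 Size) j))).

Definition literal_form (c : clause) (s : col) (b : bool) (t j t' j' : expr) : form :=
  match c with
  | inl (c1, c2, (c3, c4)) =>
      if b then FAnd (FEq t' (succ_e t)) (FAnd (FEq j' j)
        (FOr (FAnd (FEq j (Cst 0)) (FBool (s == next_column true false c1 c2 c3 c4)))
        (FOr (FAnd (FEq j (Cst 1)) (FBool (s == next_column false true c1 c2 c3 c4)))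
             (FAnd (FLe (Cst 2) j) (FBool (s == next_column false false c1 c2 c3 c4))))))
      else FAnd (FEq t' t)
        (FOr (FAnd (FBool (s == c1)) (FOr (FAnd (FEq j (Cst 0)) (FEq j' (Cst 0)))
                                          (FEq (succ_e j') j)))
        (FOr (FAnd (FBool (s == c2)) (FEq j' j))
        (FOr (FAnd (FBool (s == c3)) (FEq j' (succ_e j)))
             (FAnd (FBool (s == c4)) (FEq j' (Cst 0))))))
  | inr (inl true) =>
      FAnd (FBool b) (FAnd (FEq t' t) (FAnd (FEq j' j) (allowed_form j s)))
  | inr (inl false) => FAnd (FBool (s == @start_column M None)) (FAnd (FEq t' t)
      (if b then FEq j' (succ_e j) else FEq j' j))
  | inr (inr s0) =>
      FAnd (FBool (~~ b)) (FAnd (FBool (s == s0)) (FAnd (FEq t' t) (FEq j' j)))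
  end.

Definition hyper_form (k : kind) (l : lab) (t j t' j' : expr) : form :=
  match k with
  | inl o => FAnd (FBool (o == l.1)) (FAnd (FEq t' t) (FEq j' j))
  | inr c => FOr (FNot (guard_form c t j))
      (FOr (FAnd (FBool (l == (None, true))) (FAnd (FEq t' (Cst 0)) (FEq j' (Cst 0))))
        (match l.1 with
         | Some s => literal_form c s l.2 t j t' j'
         | None => FBool false
         end))
  end.

Lemma guard_formP x env c i k :
  sem x env (guard_form c (Var i) (Var k)) <->
  guard x (dim x) c (nth 0 env i) (nth 0 env k).
Proof.
rewrite -(eval_dim x env).
by case: c => [c|[[]|s]]; apply: iff_refl.
Qed.

(** Both orders of the coordinates occur, as the hyperedge may index the row or the column of the
    adjacency matrix. *)
Lemma literal_formP x a b c d cl s be :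
  let env := [:: a; b; c; d] in
  (sem x env (literal_form cl s be (Var 0) (Var 1) (Var 2) (Var 3)) <->
   literal x (guess_len x) cl s be a b c d) /\
  (sem x env (literal_form cl s be (Var 2) (Var 3) (Var 0) (Var 1)) <->
   literal x (guess_len x) cl s be c d a b).
Proof.
move=> env; rewrite -(eval_guess x env).
by case: cl => [[[c1 c2] [c3 c4]]|[[]|s0]]; case: be; split; apply: iff_refl.
Qed.

Lemma hyper_formP x a b c d k l :
  let env := [:: a; b; c; d] in
  (sem x env (hyper_form k l (Var 0) (Var 1) (Var 2) (Var 3)) <->
   hyper x (guess_len x) (dim x) k l a b c d) /\
  (sem x env (hyper_form k l (Var 2) (Var 3) (Var 0) (Var 1)) <->
   hyper x (guess_len x) (dim x) k l c d a b).
Proof.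
move=> env; case: k => [o|cl]; first by split; apply: iff_refl.
case: l => [[s|] be]; rewrite /hyper /hyper_form [fst _]/= [snd _]/=.
  have [h1 h2] := literal_formP x a b c d cl s be.
  have g1 := guard_formP x env cl 0 1; have g2 := guard_formP x env cl 2 3.
  by split; [rewrite -h1 -g1 | rewrite -h2 -g2]; apply: iff_refl.
have g1 := guard_formP x env cl 0 1; have g2 := guard_formP x env cl 2 3.
by split; [rewrite -g1 | rewrite -g2]; apply: iff_refl.
Qed.

Definition adj_form (a b : kind + lab) : form :=
  match a, b with
  | inl k, inl k' =>
      FNot (FAnd (FBool (k == k')) (FAnd (FEq (Var 0) (Var 2)) (FEq (Var 1) (Var 3))))
  | inl k, inr l => hyper_form k l (Var 0) (Var 1) (Var 2) (Var 3)
  | inr l, inl k => hyper_form k l (Var 2) (Var 3) (Var 0) (Var 1)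
  | inr _, inr _ => FBool false
  end.

Section Graph.

Variable x : word.

Let N := dim x.
Let P := guess_len x.

Definition gvertex : finType := ('I_N * 'I_N * (kind + lab))%type.

(** Adjacency is the value of the compiled formula itself, which is the bit that the reduction
    writes. *)
Definition gadj : rel gvertex := fun v v' =>
  0 < eval x [:: nat_of_ord v.1.1; nat_of_ord v.1.2;
              nat_of_ord v'.1.1; nat_of_ord v'.1.2] (expr_of (adj_form v.2 v'.2)).

Lemma gadj_kk t j k t' j' k' :
  gadj (t, j, inl k) (t', j', inl k') = ((t, j, inl k : kind + lab) != (t', j', inl k')).
Proof.
apply/idP/idP => [/sem_iff h|h].
  by apply/eqP => -[et ej ek]; apply: h; subst; rewrite /= eqxx.
apply/sem_iff => -[/= /eqP ek [/ord_inj et /ord_inj ej]].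
by rewrite ek et ej eqxx in h.
Qed.

Lemma gadj_kl t j k t' j' l :
  gadj (t, j, inl k) (t', j', inr l) <-> hyper x P N k l t j t' j'.
Proof.
rewrite /gadj -sem_iff.
exact: (hyper_formP x t j t' j' k l).1.
Qed.

Lemma gadj_lk t j k t' j' l :
  gadj (t', j', inr l) (t, j, inl k) <-> hyper x P N k l t j t' j'.
Proof.
rewrite /gadj -sem_iff.
exact: (hyper_formP x t' j' t j k l).2.
Qed.

Lemma gadj_ll a l a' l' : gadj (a, inr l) (a', inr l') = false.
Proof. by []. Qed.

Lemma gadj_sym : symmetric gadj.
Proof.
move=> [[t j] [k|l]] [[t' j'] [k'|l']]; rewrite ?gadj_kk ?gadj_ll //.
- by rewrite eq_sym.
- by apply/idP/idP => [/gadj_kl|/gadj_lk] h; [apply/gadj_lk | apply/gadj_kl].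
- by apply/idP/idP => [/gadj_lk|/gadj_kl] h; [apply/gadj_kl | apply/gadj_lk].
Qed.

Lemma gadj_irr : irreflexive gadj.
Proof. by move=> [[t j] [k|l]]; rewrite ?gadj_kk ?eqxx. Qed.

Definition red_graph : sgraph := SGraph gadj_sym gadj_irr.

Definition is_kind : pred red_graph := fun v => if v.2 is inl _ then true else false.

Lemma card_is_kind : #|is_kind| = N * N * #|kind|.
Proof.
pose f (w : 'I_N * 'I_N * kind) : gvertex := (w.1, inl w.2).
have fi : injective f by move=> [a k] [a' k'] [-> ->].
transitivity #|{: 'I_N * 'I_N * kind}|; last by rewrite !card_prod !card_ord.
rewrite -(card_image fi); apply: eq_card => -[a [k|l]]; apply/idP/idP => //.
  by move=> _; apply/imageP; exists (a, k).
by case/imageP => -[].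
Qed.

Lemma dim_gt : 2 * size x + 1 + P < N.
Proof. by rewrite /N /dim -/P; lia. Qed.

Lemma dim_gt0 : 0 < N.
Proof. by have := dim_gt; lia. Qed.

Definition satisfies (v : nat -> nat -> col -> bool) : Prop :=
  forall t j c, t < N -> j < N -> guard x N c t j ->
    exists t' j' s b, [/\ t' < N, j' < N, literal x P c s b t j t' j' & b = v t' j' s].

(** Literals are coloured by their truth value, with the constant [None] counted as a false
    variable. *)
Definition truth (v : nat -> nat -> col -> bool) (w : red_graph) : bool :=
  if w.2 is inr (o, b) then
    b == (if o is Some s then v w.1.1 w.1.2 s else false)
  else false.

Lemma splitting_satisfies :
  (exists cl, splitting is_kind cl) <-> exists v, satisfies v.
Proof.
have n0 := dim_gt0; pose z : 'I_N := Ordinal n0.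
split=> [[cl hcl]|[v hv]].
  (* The colour [f0] of the constant is read as false. A clause also needs a point of the other
     colour, which is then a true literal. *)
  have [f0 ef0] : exists f0, f0 = cl (z, z, inr (None, true)) by eexists.
  have neg t j o : cl (t, j, inr (o, false)) = ~~ cl (t, j, inr (o, true)).
    have hk : is_kind (t, j, inl (inl o)) by [].
    have wit b : exists2 d, cl (t, j, inr (o, d)) = b & true.
      have [[[t' j'] [//|[o' d]]] _ /andP[/gadj_kl]] := hcl _ b hk.
      by move=> [/eqP /= -> [/ord_inj -> /ord_inj ->]] /eqP <-; exists d.
    have [[] e1 _] := wit true; have [[] e2 _] := wit false; rewrite ?e1 ?e2 //.
    - by rewrite e1 in e2.
    - by rewrite e1 in e2.
  pose v t j s := cl (insubd z t, insubd z j, inr (Some s, true)) != f0.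
  have vE (t j : 'I_N) s b : (b == v t j s) = (cl (t, j, inr (Some s, b)) != f0).
    rewrite /v !valKd; case: b; first by case: (cl _ != f0).
    by rewrite neg; case: (cl _); case: (f0).
  exists v => t j c ht hj hg.
  have hk : is_kind (Ordinal ht, Ordinal hj, inl (inr c)) by [].
  have [[[t' j'] [//|[o d]]] _ /andP[/gadj_kl]] := hcl _ (~~ f0) hk.
  case=> [//|[[/eqP [-> ->] [/= et ej]]|]].
    have -> : t' = z by apply: ord_inj.
    have -> : j' = z by apply: ord_inj.
    by rewrite -ef0; case: (f0).
  case: o => [s|] //= hl /eqP hc.
  exists t', j', s, d; split; try exact: ltn_ord; first exact: hl.
  by apply/eqP; rewrite vE hc; case: (f0).
exists (truth v) => -[[t j] [k|//]] b _.
case: k => [o|c].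
  pose w := (t, j, inr (o, (if o is Some s then v t j s else false) == b)) : red_graph.
  exists w => //; apply/andP; split; first by apply/gadj_kl.
  by rewrite /truth /=; case: o {w} => [s|]; [case: (v t j s) |]; case: b.
(* The guard is decidable because it is the meaning of a formula. *)
have [hg|ng] : guard x N c t j \/ ~ guard x N c t j.
  rewrite -(guard_formP x [:: nat_of_ord t; nat_of_ord j] c 0 1) sem_iff.
  by case: (0 < _); [left | right].
(* The constant supplies the colour false and a satisfied literal supplies the colour true. *)
- case: b; last first.
    exists (z, z, inr (None, true)) => //; apply/andP; split=> //.
    by apply/gadj_kl; right; left.
  have [t' [j' [s [b [ht hj hl hb]]]]] := hv t j c (ltn_ord t) (ltn_ord j) hg.
  exists (Ordinal ht, Ordinal hj, inr (Some s, b)) => //; apply/andP; split.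
    by apply/gadj_kl; right; right.
  by rewrite /truth /= hb eqxx.
(* Outside its guard the clause contains every point; the constant and its negation have both
   colours. *)
- exists (z, z, inr (None, ~~ b)) => //; apply/andP; split.
    by apply/gadj_kl; left.
  by rewrite /truth /=; case: b.
Qed.

(** The same assignment serves on both sides, since the guarded clauses are the conditions of
    [tableau] in clausal form. *)
Lemma satisfies_tableau : (exists v, satisfies v) <-> exists v, @tableau M x P N v.
Proof.
have hN := dim_gt.
split=> -[v hv]; exists v.
  split.
  - move=> t j ht hj a b c d ha hb hc hd.
    have [|||t' [j' [s [be [_ _ hl e]]]]] := hv t j (inl (a, b, (c, d))).
    + lia.
    + lia.
    + by split; lia.
    case: be hl e => /=.
      move=> [-> [-> hs]] e.
      suff <- : s = next_column (j == 0) (j == 1) a b c d by rewrite -e.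
      case: hs => [[-> /eqP ->]|[[-> /eqP ->]|[h2 /eqP ->]]] //.
      by case: j h2 {ht hj ha hb hc hd e} => [|[|]].
    move=> [-> hs] e; exfalso; move: e.
    case: hs => [[/eqP -> hj']|[[/eqP -> ->]|[[/eqP -> ->]|[/eqP -> ->]]]];
      rewrite ?hb ?hc ?hd //.
    have -> : j' = j.-1 by case: hj' => [[-> ->]|<-] //; rewrite addn1.
    by rewrite ha.
  - move=> j hj.
    have [|t' [j' [s [be [_ _ [hb [-> [-> ha]]] e]]]]] :=
      hv 0 j (inr (inl true)) _ hj erefl; first lia.
    by exists s; rewrite // -e.
  - move=> j h1 h2 hb.
    have [|||t' [j' [s [be [_ _ [/eqP -> [-> hj']] e]]]]] := hv 0 j (inr (inl false)).
    + lia.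
    + lia.
    + by split=> //; split=> //; lia.
    by case: be hj' e => -> //; rewrite hb.
  - move=> t j s ht hj hr hs.
    have [t' [j' [s' [be [_ _ [hb [/eqP -> [-> ->]]] e]]]]] := hv t j (inr (inr s)) ht hj hr.
    by rewrite e hs in hb.
have [h1 h2 h3 h4] := hv.
move=> t j [[[a b] [c d]]|[[]|s]] ht hj /=.
- move=> [gt gj].
  (* A premise that fails provides a true negated literal; if all four hold, the positive literal is
     true. *)
  case ea: (v t j.-1 a); last first.
    exists t, j.-1, a, false; split; [lia | lia | | by rewrite ea].
    split=> //; left; split=> //; case: (j) => [|j0]; first by left.
    by right; rewrite addn1.
  case eb: (v t j b); last first.
    exists t, j, b, false; split; [lia | lia | | by rewrite eb].
    by split=> //; right; left.
  case ec: (v t (j + 1) c); last first.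
    exists t, (j + 1), c, false; split; [lia | lia | | by rewrite ec].
    by split=> //; right; right; left.
  case ed: (v t 0 d); last first.
    exists t, 0, d, false; split; [lia | lia | | by rewrite ed].
    by split=> //; right; right; right.
  exists (t + 1), j, (next_column (j == 0) (j == 1) a b c d), true; split; try lia.
    split=> //; split=> //; case: (j) => [|[|j0]]; first by left.
      by right; left.
    by right; right.
  by apply/esym/h1 => //; lia.
- move=> ->; have [s ha hs] := h2 j hj.
  by exists 0, j, s, true; split=> //; lia.
- move=> [-> [gj gN]]; case e: (v 0 j (@start_column M None)); last first.
    by exists 0, j, (@start_column M None), false; split=> //; lia.
  exists 0, (j + 1), (@start_column M None), true; split=> //; try lia.
  by apply/esym/h3 => //; lia.
- move=> hr; exists t, j, s, false; split=> //.
  by apply/esym/negP; apply: h4.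
Qed.

End Graph.
End Reduction.

(** * The word written by the reduction *)

Definition wcats (s : seq wexpr) : wexpr :=
  foldr WCat (WFor (Cst 0) (WBit (Cst 0))) s.

Lemma weval_wcats w env s : weval w env (wcats s) = flatten [seq weval w env x | x <- s].
Proof. by elim: s => //= x s ->. Qed.

(** The marks of [pair_word] are inserted at the level of expressions, bit by bit, as the word is
    produced. *)
Fixpoint wdouble (x : wexpr) : wexpr :=
  match x with
  | WBit e => WCat (WBit (Cst 1)) (WBit e)
  | WCat a b => WCat (wdouble a) (wdouble b)
  | WFor e a => WFor e (wdouble a)
  end.

Lemma weval_wdouble w env x :
  weval w env (wdouble x) = flatten [seq [:: true; b] | b <- weval w env x].
Proof.
elim: x env => [e|a IHa b IHb|e a IH] env //=; first by rewrite IHa IHb map_cat flatten_cat.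
elim: (iota _ _) => //= i s IHs.
by rewrite IHs IH map_cat flatten_cat.
Qed.

Definition wones (e : expr) : wexpr := WFor e (WBit (Cst 1)).

Lemma weval_wones w env e : weval w env (wones e) = nseq (eval w env e) true.
Proof.
by rewrite /= -{2}[eval w env e](size_iota 0); elim: (iota _ _) => //= i s ->.
Qed.

Lemma enum_prod (A B : finType) :
  enum {: A * B} = [seq (a, b) | a <- enum A, b <- enum B].
Proof. by rewrite [LHS]enumT unlock. Qed.

Lemma flatten_enum_prod (A B : finType) (T : Type) (g : A * B -> seq T) :
  flatten [seq g v | v <- enum {: A * B}] =
  flatten [seq flatten [seq g (a, b) | b <- enum B] | a <- enum A].
Proof.
rewrite enum_prod; elim: (enum A) => //= a s IH.
by rewrite map_cat flatten_cat IH -map_comp.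
Qed.

Lemma flatten_enum_ord n (T : Type) (g : nat -> seq T) :
  flatten [seq g (nat_of_ord i) | i <- enum 'I_n] = flatten [seq g i | i <- iota 0 n].
Proof. by rewrite -(val_enum_ord n) -map_comp. Qed.

(** Products are enumerated lexicographically, which is the order of nested loops. *)
Lemma flatten_enum_grid n (A : finType) (T : Type) (g : nat -> nat -> A -> seq T) :
  flatten [seq g (nat_of_ord v.1.1) (nat_of_ord v.1.2) v.2 | v <- enum {: 'I_n * 'I_n * A}] =
  flatten [seq flatten [seq flatten [seq g i j a | a <- enum A] | j <- iota 0 n]
          | i <- iota 0 n].
Proof.
rewrite flatten_enum_prod /= flatten_enum_prod /= -flatten_enum_ord.
by congr flatten; apply: eq_map => i; rewrite -flatten_enum_ord.
Qed.

Section ReductionWord.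

Variables (M : TM) (p q : {poly nat}).

Let label : finType := (kind M + lab M)%type.
Let N : expr := dim_expr p q.

(** The loops bind the row coordinates at levels 0 and 1 and the column coordinates at 2 and 3, as
    [adj_form] expects. The labels depend on the machine only and are listed explicitly. *)
Definition red_matrix : wexpr :=
  WFor N (WFor N (wcats [seq
    WFor N (WFor N (wcats [seq WBit (expr_of (adj_form p q a b)) | b <- enum label]))
    | a <- enum label])).

Definition red_graph_word : wexpr :=
  WCat (wones (Mul (Mul N N) (Cst #|label|))) (WCat (WBit (Cst 0)) red_matrix).

Definition target_size : expr := Add (Mul (Mul N N) (Cst #|kind M|)) (Cst 2).

Definition target_form : form :=
  FAnd (FNot (FEq (Var 0) (Var 1))) (FNot (FEq (Add (Var 0) (Var 1)) (Cst 1))).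

Definition target_word : wexpr :=
  WCat (wones target_size) (WCat (WBit (Cst 0))
    (WFor target_size (WFor target_size (WBit (expr_of target_form))))).

Definition reduction : wexpr :=
  WCat (wdouble red_graph_word) (WCat (WBit (Cst 0)) target_word).

Definition target (x : word) : sgraph :=
  clique_minus_edge (dim p q x * dim p q x * #|kind M|).

Lemma red_graph_wordE x : weval x [::] red_graph_word = graph_code (red_graph M p q x).
Proof.
have eN env : eval x env N = dim p q x by apply: eval_dim.
rewrite -[LHS]/(weval x [::] (wones (Mul (Mul N N) (Cst #|label|))) ++
  false :: weval x [::] red_matrix) weval_wones.
have -> : eval x [::] (Mul (Mul N N) (Cst #|label|)) = #|red_graph M p q x|.
  by rewrite -[LHS]/(eval x [::] N * eval x [::] N * #|label|) eN !card_prod !card_ord.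
congr (_ ++ _ :: _).
pose n := dim p q x.
pose bit i j a i' j' b := 0 < eval x [:: i; j; i'; j'] (expr_of (@adj_form M p q a b)).
pose row i j a := flatten [seq [:: bit i j a (nat_of_ord v.1.1) (nat_of_ord v.1.2) v.2]
  | v <- enum {: 'I_n * 'I_n * label}].
transitivity (flatten [seq row (nat_of_ord v.1.1) (nat_of_ord v.1.2) v.2
  | v <- enum {: 'I_n * 'I_n * label}]); last first.
  congr flatten; apply: eq_map => v.
  rewrite /row; elim: (enum _) => //= v' s ->.
  by [].
rewrite flatten_enum_grid.
rewrite -[LHS]/(flatten [seq flatten [seq weval x [:: i; j] (wcats [seq
    WFor N (WFor N (wcats [seq WBit (expr_of (adj_form p q a b)) | b <- enum label]))
    | a <- enum label]) | j <- iota 0 (eval x [:: i] N)] | i <- iota 0 (eval x [::] N)]).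
rewrite eN; congr flatten; apply: eq_map => i; rewrite eN.
congr flatten; apply: eq_map => j; rewrite weval_wcats -map_comp.
congr flatten; apply: eq_map => a; rewrite /row
  (@flatten_enum_grid n label bool (fun i' j' b => [:: bit i j a i' j' b])).
rewrite -[LHS]/(flatten [seq flatten [seq weval x [:: i; j; i'; j'] (wcats
   [seq WBit (expr_of (adj_form p q a b)) | b <- enum label])
    | j' <- iota 0 (eval x [:: i; j; i'] N)] | i' <- iota 0 (eval x [:: i; j] N)]).
rewrite eN; congr flatten; apply: eq_map => i'; rewrite eN.
congr flatten; apply: eq_map => j'; rewrite weval_wcats -map_comp.
by congr flatten; apply: eq_map.
Qed.

Lemma target_wordE x : weval x [::] target_word = graph_code (target x).
Proof.
have eN env : eval x env N = dim p q x by apply: eval_dim.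
set k := dim p q x * dim p q x * #|kind M|.
have eT env : eval x env target_size = k.+2.
  by rewrite -[LHS]/(eval x env N * eval x env N * #|kind M| + 2) eN addn2.
rewrite -[LHS]/(weval x [::] (wones target_size) ++ false ::
  flatten [seq flatten [seq [:: 0 < eval x [:: i; j] (expr_of target_form)]
    | j <- iota 0 (eval x [:: i] target_size)] | i <- iota 0 (eval x [::] target_size)]).
rewrite weval_wones !eT /graph_code card_ord; congr (_ ++ _ :: _).
have hb i j : (0 < eval x [:: i; j] (expr_of target_form)) = (i != j) && (i + j != 1).
  apply/idP/andP => [/sem_iff [h1 h2]|[/eqP h1 /eqP h2]]; last by apply/sem_iff.
  by split; apply/eqP.
rewrite -flatten_enum_ord; congr flatten; apply: eq_map => i; rewrite eT.
by rewrite -flatten_enum_ord; elim: (enum _) => //= j s ->; rewrite hb.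
Qed.

Lemma reductionE x : weval x [::] reduction =
  pair_word (graph_code (red_graph M p q x)) (graph_code (target x)).
Proof.
rewrite -[LHS]/(weval x [::] (wdouble red_graph_word) ++ false :: weval x [::] target_word).
by rewrite weval_wdouble red_graph_wordE target_wordE.
Qed.

End ReductionWord.

(** * NP-hardness *)

Lemma pair_word_inj x y x' y' : pair_word x y = pair_word x' y' -> x = x' /\ y = y'.
Proof.
elim: x x' => [|b x IH] [|b' x'] //; first by case.
by rewrite !pair_word_cons => -[-> /IH [-> ->]].
Qed.

(** The length of a code determines the number of vertices; matching ranks then preserves the
    matrix. *)
Lemma graph_code_iso (G G' : sgraph) : graph_code G = graph_code G' -> graph_iso G G'.
Proof.
move=> e; have eN : #|G| = #|G'|.
  by have := congr1 size e; rewrite !size_graph_code; nia.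
exists (fun x => enum_val (cast_ord eN (enum_rank x))).
  exists (fun x => enum_val (cast_ord (esym eN) (enum_rank x))) => x.
    by rewrite enum_valK cast_ordK enum_rankK.
  by rewrite enum_valK cast_ordKV enum_rankK.
by move=> x y; rewrite -nth_graph_code_rank -e !enum_valK /= -eN nth_graph_code_rank.
Qed.

Lemma identifies_to_iso (G G' H H' : sgraph) : graph_iso G' G -> graph_iso H H' ->
  identifies_to G H -> identifies_to G' H'.
Proof.
move=> [g [gi giK gK] hg] [h [hi hiK hK] hh] /identifies_toP [f [sf hf]].
apply/identifies_toP; exists (h \o f \o g); split=> [a|a b ab].
  by have [x ex] := sf (hi a); exists (gi x); rewrite /= gK ex hK.
have ne : hi a != hi b by rewrite (inj_eq (can_inj hK)).
rewrite -(hK a) -(hK b) hh hf //; split=> -[x [y [ex ey exy]]].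
  by exists (gi x), (gi y); rewrite /= !gK ex ey -hg !gK.
exists (g x), (g y); rewrite hg; split=> //; apply: (can_inj hiK); [exact: ex | exact: ey].
Qed.

(** Several instances may share a code, so the answer has to depend on the code alone; for graphs
    this is invariance under isomorphism. *)
Lemma language_code (P : problem) (i : instance P) :
  (forall j : instance P, @code P j = code i -> @yes P j -> @yes P i) ->
  language P (code i) <-> @yes P i.
Proof. by move=> h; split=> [[j e] hj|]; [apply: h hj | exists i]. Qed.

Theorem identification_NP_hard :
  NP_hard (@restrict Identification identification_class).
Proof.
move=> L [V [p [[M [q hM]] hL]]].
exists (fun x => weval x [::] (reduction M p q)); split; first exact: polytime_weval.
move=> x; set G := red_graph M p q x; set k := #|@is_kind M p q x|.
have ek : dim p q x * dim p q x * #|kind M| = k by rewrite /k card_is_kind.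
have k0 : 0 < k.
  by rewrite -ek !muln_gt0 dim_gt0; apply/card_gt0P; exists (inl None).
have hcl : identification_class (G, target M p q x).
  by rewrite /target ek; apply: clique_minus_edge_class.
pose i : instance (@restrict Identification identification_class) := exist _ (_, _) hcl.
have ei : weval x [::] (reduction M p q) = code i by apply: reductionE.
rewrite ei; split; first by exists i.
rewrite language_code; last first.
  move=> [[G' H'] hcl'] /= /pair_word_inj [eG eH].
  exact: identifies_to_iso (graph_code_iso (esym eG)) (graph_code_iso eH).
have hE : identifies_to G (target M p q x) <-> exists cl, splitting (@is_kind M p q x) cl.
  rewrite /target ek; apply: identifies_splitting => //.
    by move=> [[t j] [k1|//]] [[t' j'] [k2|//]] _ _; rewrite [adj _ _]gadj_kk.
  by move=> [[t j] [//|l]] [[t' j'] [//|l']].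
rewrite hL -[yes i]/(identifies_to G (target M p q x)) hE splitting_satisfies.
rewrite satisfies_tableau; apply: iff_sym; apply: (tableauP hM); last exact: dim_gt.
(* Since [q] is monotone, its value at the longest admissible input bounds all the running times. *)
move=> y hy; rewrite /dim -/(guess_len p x).
have := @horner_nat_mono q (size (pair_word x y)) (2 * size x + 1 + guess_len p x).
rewrite size_pair_word leq_add2l => /(_ hy) h.
by rewrite -[leqRHS]addnA; apply: leq_add h _; lia.
Qed.

Theorem theorem5p2 :
  NP_complete
    (@restrict Identification (fun GH : sgraph * sgraph =>
       let H := GH.2 in
       [/\ split_graph H, interval_graph H &
           #|[set v : H | simplicial v]| = 2])).
Proof. exact: conj identification_in_NP identification_NP_hard. Qed.
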